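(* For every $n\ge 1$, the simple dessins d'enfants form an open subset of the space $\mathfrak{D}_n$ of dessins d'enfants of completely reducible trigonal curves of maximal degree $n$.
   Context: A completely reducible trigonal curve (CRTC) $C$ is a curve given by $(y-y_1)(y-y_2)(y-y_3)=0$ with $y_1,y_2,y_3\in\mathbb{C}[x]$; its maximal degree is $\max\{\deg y_1,\deg y_2,\deg y_3\}=n\ge 1$. All curves are assumed to have no triple intersections: there is no $x_0\in\mathbb{C}$ with $y_1(x_0)=y_2(x_0)=y_3(x_0)$, and (the same condition over $x=\infty$) the coefficients of $x^n$ in $y_1,y_2,y_3$ are not all equal. Put $\lambda=\frac{y_1-y_3}{y_2-y_3}:P^1\to P^1$ and $j_C=\frac{4(\lambda^2-\lambda+1)^3}{27\lambda^2(\lambda-1)^2}:P^1\to P^1$, where $P^1=\mathbb{C}\cup\{\infty\}$. The dessin d'enfant of $C$ is the embedded graph $\Gamma_C=j_C^{-1}([0,1])\subset P^1$; its $\bullet$-vertices are the points of $j_C^{-1}(0)$ and its $\circ$-vertices are the points of $j_C^{-1}(1)$. Ramification points of $j_C$ with image in $(0,1)$ are called monochrome vertices. A dessin d'enfant is simple if all its $\bullet$-vertices have degree $3$, all its $\circ$-vertices have degree $2$, and it has no monochrome vertex. Let $\mathfrak{T}_n$ be the space of CRTCs of maximal degree $n$, i.e. of triples $(y_1,y_2,y_3)$ of polynomials in $\mathbb{C}[x]$ with $\max\{\deg y_1,\deg y_2,\deg y_3\}=n$, such that there is no $x_0\in\mathbb{C}$ with $y_1(x_0)=y_2(x_0)=y_3(x_0)$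 and the coefficients of $x^n$ in $y_1,y_2,y_3$ are not all equal, topologized by the coefficients of the polynomials $y_i$. Let $\omega$ be the map sending a curve $C\in\mathfrak{T}_n$ to its dessin $\Gamma_C$, and let $\mathfrak{D}_n=\omega(\mathfrak{T}_n)$. Dessins are deformed by continuously changing the coefficients of the $y_i$; accordingly $\mathfrak{D}_n$ carries the quotient topology for $\omega$ (a subset of $\mathfrak{D}_n$ is open if and only if its preimage in $\mathfrak{T}_n$ is open). *)

(* Defs.v *)
(* MathComp / MathComp-Analysis *)
From HB Require Import structures.
From mathcomp Require Import all_boot all_order all_algebra.
From mathcomp Require Import generic_quotient.
From mathcomp Require Import all_classical all_reals all_analysis.
From mathcomp Require Import complex.

Set Implicit Arguments.
Unset Strict Implicit.
Unset Printing Implicit Defensive.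

Import Order.TTheory GRing.Theory Num.Theory.
Import numFieldNormedType.Exports.

Local Open Scope ring_scope.
Local Open Scope classical_set_scope.
Local Open Scope complex_scope.

(* The usual topology and normed structure of the complex numbers, which the
   libraries only provide on the alias R[i]^o. *)
#[warnings="-redundant-canonical-projection"]
HB.instance Definition _ (R : rcfType) := NormedModule.copy R[i] R[i]^o.

(* The Riemann sphere; Some x is the finite point x and None is infinity. *)
Notation P1 R := (one_point_compactification (complex R)).

Section RationalMaps.
Variable R : realType.
Local Notation C := (R[i]).

(* The map P^1 -> P^1 given by p / q, for coprime p and q. With d the larger of
   the two degrees, its value at infinity is the ratio of the coefficients of
   x^d. *)
Definition ratmap (p q : {poly C}) (z : P1 R) : P1 R :=
  let ratio (a b : C) := if b == 0 then None else Some (a / b) in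
  if z is Some x then ratio p.[x] q.[x]
  else let d := (maxn (size p) (size q)).-1 in ratio p`_d q`_d.

(* The local coordinate at z : x = x0 + t at a finite point x0 and x = 1 / t at
   infinity. *)
Definition chart (z : P1 R) (t : C) : P1 R :=
  if z is Some x0 then Some (x0 + t)
  else if t == 0 then None else Some t^-1.

(* z is a ramification point of f, when f is holomorphic near z and f z is
   finite: the derivative of f in the local coordinate vanishes at z. The
   default value 0 only matters at points where f is infinite. *)
Definition ramified (f : P1 R -> P1 R) (z : P1 R) : Prop :=
  is_derive (0 : C) (1 : C) (fun t : C => odflt 0 (f (chart z t))) 0.

End RationalMaps.

(* The degree of v in G is k, i.e. k edge-ends of G meet at v: near v, G is the
   union of k simple arcs issuing from v which pairwise meet at v only (and G is
   {v} near v when k = 0). A loop at v counts twice. *)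
Definition vertex_degree (R : realType) (G : set (P1 R)) (v : P1 R) (k : nat)
    : Prop :=
  exists gamma : 'I_k -> R -> P1 R,
  [/\ forall i, {within `[0, 1], continuous (gamma i)},
      forall i, set_inj `[0, 1] (gamma i),
      forall i, gamma i 0 = v,
      forall i j, i != j ->
        (gamma i @` `[0, 1]) `&` (gamma j @` `[0, 1]) = [set v]
    & \forall z \near v, G z <-> z = v \/ exists i, (gamma i @` `[0, 1]) z].

Record dessin (R : realType) := Dessin {
  graph : set (P1 R);
  bullets : set (P1 R);
  circles : set (P1 R);
  monochromes : set (P1 R) }.

Definition simple (R : realType) (D : dessin R) : Prop :=
  [/\ forall v, bullets D v -> vertex_degree (graph D) v 3,
      forall v, circles D v -> vertex_degree (graph D) v 2
    & monochromes D = set0].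

(* The space T_n. Since n + 1 = max (size y_i) > 0, the degree condition reads
   max (deg y_i) = n with the zero polynomial having degree - oo. *)
Record crtc (R : realType) (n : nat) := Crtc {
  y1 : {poly R[i]};
  y2 : {poly R[i]};
  y3 : {poly R[i]};
  crtc_maxdeg : maxn (size y1) (maxn (size y2) (size y3)) = n.+1;
  crtc_no_triple : forall x : R[i], ~ (y1.[x] = y2.[x] /\ y2.[x] = y3.[x]);
  crtc_no_triple_infty : ~ (y1`_n = y2`_n /\ y2`_n = y3`_n) }.

Section DessinOfCurve.
Variables (R : realType) (n : nat).

Definition coefficients (C : crtc R n) :
    'rV[R[i]]_n.+1 * 'rV[R[i]]_n.+1 * 'rV[R[i]]_n.+1 :=
  (poly_rV (y1 C), poly_rV (y2 C), poly_rV (y3 C)).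

HB.instance Definition _ := gen_eqMixin (crtc R n).
HB.instance Definition _ := gen_choiceMixin (crtc R n).
HB.instance Definition _ :=
  Topological.copy (crtc R n) (initial_topology coefficients).

(* y1 - y3 and y2 - y3 are coprime because there is no triple intersection. *)
Definition lambda (C : crtc R n) : P1 R -> P1 R :=
  ratmap (y1 C - y3 C) (y2 C - y3 C).

Definition j_of_lambda : P1 R -> P1 R :=
  ratmap (4 *: ('X^2 - 'X + 1) ^+ 3) (27 *: ('X^2 * ('X - 1) ^+ 2)).

Definition j_inv (C : crtc R n) : P1 R -> P1 R := j_of_lambda \o lambda C.

Definition real_pts (A : set R) : set (P1 R) := [set Some r%:C | r in A].

Definition dessin_of (C : crtc R n) : dessin R := {|
  graph := j_inv C @^-1` real_pts `[0, 1];
  bullets := j_inv C @^-1` [set Some 0];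
  circles := j_inv C @^-1` [set Some 1];
  monochromes := [set z | ramified (j_inv C) z] `&`
                 j_inv C @^-1` real_pts `]0, 1[ |}.

Definition dessins : Type := range dessin_of.

Definition omega (C : crtc R n) : dessins :=
  SigSub (mem_set (imageT dessin_of C)).

Lemma omega_surj (D : dessins) : exists C, omega C = D.
Proof.
by have /set_mem[C _ DC] := svalP D; exists C; exact: val_inj.
Qed.

Definition omega_repr (D : dessins) : crtc R n := sval (cid (omega_surj D)).

Lemma omega_reprK : cancel omega_repr omega.
Proof. by move=> D; rewrite /omega_repr; case: cid. Qed.

HB.instance Definition _ := isQuotient.Build (crtc R n) dessins omega_reprK.

(* D_n = omega (T_n), with the quotient topology for omega. *)
Definition dessin_space : topologicalType := quotient_topology dessins.

(* Not val, which for this type is a section dessin_space -> crtc R n of the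
   quotient map. *)
Definition dessin_val (D : dessin_space) : dessin R := sval (D : dessins).

End DessinOfCurve.
Arguments dessin_space : clear implicits.

(* Main.v *)
Require Import Defs.
From mathcomp Require Import all_boot all_order all_algebra.
From mathcomp Require Import generic_quotient.
From mathcomp Require Import all_classical all_reals all_analysis.
From mathcomp Require Import complex ring lra.

(** The theorem holds because the simple dessins are those of the curves for
    which lambda has no critical point on the dessin, and this condition is open.

    Let zeta be a primitive cube root of 1, u = y1 + zeta y2 + zeta^2 y3 and
    v = - (y1 + zeta^2 y2 + zeta y3). Up to a linear change of coordinates on the
    target sphere, lambda is f = u / v, and j = 4 m / (1 + m)^2 with m = f^3. So
    j lies in [0, 1] exactly when f^3 is a nonnegative real or infinite: the
    dessin is the preimage by f of three rays from 0 to infinity. The bullets are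
    the preimages of the two ends of the rays, the circles those of the three
    cube roots of 1. These facts are j_of_proj_point, graph_resolventP,
    bullet_resolventP and circle_resolventP; graph_chart transports them to local
    coordinates.

    Vertex degrees are topological. If f is unramified at z, it is a
    homeomorphism near z and the dessin has at z the degree of the rays at f z,
    which is 3 at a bullet and 2 at a circle (star_degree_unramified). If f is
    ramified at z, points w close to f z have at least two preimages close to z
    (two_preimages_near). An arc of the dessin at z is mapped injectively into one
    of the k arcs at f z, so it meets at most one preimage of each w; taking one w
    on each of the k arcs, k arcs at z would have to carry 2 k points, and the
    degree at z cannot be k (star_degree_branched). As j has no critical point
    over the open interval (0, 1), the monochrome vertices are the critical points
    of f with j in (0, 1). Hence a dessin is simple if and only if f is unramified
    at all its points (simple_nondegenerate).

    The curves with a critical point of lambda on the dessin are the projection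
    of a closed set of pairs (point of the sphere, curve). The sphere being
    covered by two compact squares, one in each of the standard charts, this
    projection is closed
    (nondegenerate_open). Openness of the set of simple dessins in the quotient
    topology is openness of the set of curves with a simple dessin. *)

Set Implicit Arguments.
Unset Strict Implicit.
Unset Printing Implicit Defensive.

Import Order.TTheory GRing.Theory Num.Theory.
Import numFieldNormedType.Exports.

Local Open Scope ring_scope.
Local Open Scope classical_set_scope.

(** * Stars of arcs *)

Section Stars.
Variable R : realType.

(** The clauses are those of [vertex_degree] with the arcs made explicit. They are
    stated over any space to serve both on the sphere and in coordinate planes; on
    the sphere, [star_degree] below unfolds to [vertex_degree]. *)
Definition star (T : topologicalType) (G : set T) (v : T) (k : nat)
    (gamma : 'I_k -> R -> T) : Prop :=
  [/\ forall i, {within `[0, 1], continuous (gamma i)},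
      forall i, set_inj `[0, 1] (gamma i),
      forall i, gamma i 0 = v,
      forall i j, i != j ->
        (gamma i @` `[0, 1]) `&` (gamma j @` `[0, 1]) = [set v]
    & \forall z \near v, G z <-> z = v \/ exists i, (gamma i @` `[0, 1]) z].

Definition star_degree (T : topologicalType) (G : set T) (v : T) (k : nat) :=
  exists gamma : 'I_k -> R -> T, star G v gamma.

Lemma within_near (T : topologicalType) (A : set R) (g : R -> T) (t : R)
    (N : set T) :
  {within A, continuous g} -> A t -> nbhs (g t) N ->
  exists2 e, 0 < e & forall u, A u -> `|t - u| < e -> N (g u).
Proof.
move=> /subspace_continuousP cg At Ngt.
have /nbhs_ballP[e /= e0 He] := cg t At N Ngt.
by exists e => // u Au tu; apply: He.
Qed.

Lemma within_unit_near0 (T : topologicalType) (g : R -> T) (N : set T) :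
  {within `[0, 1], continuous g} -> nbhs (g 0) N ->
  exists2 e, 0 < e <= 1 & forall u, u \in `[0, 1]%R -> u <= e -> N (g u).
Proof.
move=> cg Ng; have [|e e0 He] := within_near cg _ Ng.
  by rewrite /= in_itv /= lexx ler01.
exists (Num.min 1 (e / 2)).
  by rewrite lt_min ltr01 divr_gt0 //= ge_min lexx.
move=> u u01; rewrite le_min => /andP[u1 ue]; apply: He => //.
have u0 : 0 <= u by move: u01; rewrite in_itv => /andP[].
by rewrite sub0r normrN ger0_norm // (le_lt_trans ue) // ltr_pdivrMr //; lra.
Qed.

(** Compactness of the unit interval makes an injective arc in a Hausdorff space
    a homeomorphism onto its image; this is the continuity of its inverse at one
    point. *)
Lemma arc_inverse_continuous (T : topologicalType) (g : R -> T) (u0 e : R) :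
  hausdorff_space T -> {within `[0, 1], continuous g} -> set_inj `[0, 1] g ->
  u0 \in `[0, 1]%R -> 0 < e ->
  \forall z \near g u0, forall u, u \in `[0, 1]%R -> g u = z -> `|u0 - u| < e.
Proof.
move=> hT cg ig u01 e0.
pose A := `[0, 1]%classic `&` ~` ball u0 e.
have cA : compact A.
  apply: compact_closedI; first exact: segment_compact.
  exact/open_closedC/ball_open.
have clA : closed (g @` A).
  apply: compact_closed => //; apply: continuous_compact cA.
  by apply: continuous_subspaceW cg => t [].
have : nbhs (g u0) (~` (g @` A)).
  apply: open_nbhs_nbhs; split; first exact: closed_openC.
  move=> [u [u01' nb] guE]; apply: nb; rewrite (ig u u0) ?inE //.
  exact: ballxx.
apply: filterS => z nAz u u1 guz; apply: contrapT => nb.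
by apply: nAz; exists u => //; split.
Qed.

(** Relatively to I, the complement of one A j is the finite union of the others,
    so each A j is both closed and open. *)
Lemma connected_in_one_closed (T : topologicalType) (k : nat) (A : 'I_k -> set T)
    (I : set T) :
  (forall j, closed (A j)) -> connected I -> I !=set0 ->
  (forall z, I z -> exists j, A j z) ->
  (forall i j z, I z -> A i z -> A j z -> i = j) ->
  exists j, I `<=` A j.
Proof.
move=> clA cI [z0 Iz0] cov disj; have [j0 Aj0] := cov _ Iz0.
exists j0; suff -> : I = I `&` A j0 by move=> z [].
symmetry; apply: cI; first by exists z0.
  exists (~` (\bigcup_(j in [set j | j != j0]) A j)).
    apply: closed_openC; rewrite -bigsetU_fset_set; last exact: finite_finset.
    exact: closed_bigsetU.
  apply/seteqP; split=> z [Iz] H; split=> //.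
    by move=> [j /= jj0 Aj]; move/eqP: jj0; apply; apply: disj Iz Aj H.
  have [j Aj] := cov _ Iz; have [<- //|/eqP jj0] := pselect (j = j0).
  by case: H; exists j.
by exists (A j0).
Qed.

Lemma shrink_arc_continuous (T : topologicalType) (g : R -> T) (e : R) :
  0 < e <= 1 -> {within `[0, 1], continuous g} ->
  {within `[0, 1], continuous (fun t => g (e * t))}.
Proof.
move=> /andP[e0 e1] cg; apply/subspace_continuousP => t t01 N Ngt.
have et01 u : `[0, 1]%classic u -> `[0, 1]%classic (e * u).
  rewrite /= !in_itv /= => /andP[u0 u1].
  by rewrite mulr_ge0 ?(ltW e0) //= mulr_ile1 // ltW.
have [d d0 Hd] := within_near cg (et01 t t01) Ngt.
apply/nbhs_ballP; exists d => //= u tu u01; apply: Hd; first exact: et01.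
rewrite -mulrBr normrM gtr0_norm // (le_lt_trans _ tu) //.
by rewrite ler_piMl.
Qed.

(** The part of an arc that is cut off is compact and avoids v, so it stays away
    from v and the germ of G at v does not change. *)
Lemma star_shrink (T : topologicalType) (G U : set T) (v : T) (k : nat)
    (gamma : 'I_k -> R -> T) :
  hausdorff_space T -> star G v gamma -> nbhs v U ->
  exists2 gamma' : 'I_k -> R -> T, star G v gamma' &
    forall i t, t \in `[0, 1]%R -> U (gamma' i t) /\ G (gamma' i t).
Proof.
move=> hT [cg ig g0 dg Gg] Uv.
have /choice[e He] : forall i, exists e, 0 < e <= 1 /\
    forall u, u \in `[0, 1]%R -> u <= e -> U (gamma i u) /\ G (gamma i u).
  move=> i.
  have nUG : nbhs (gamma i 0) (U `&` [set z | G z <-> z = v \/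
      exists i, (gamma i @` `[0, 1]) z]) by rewrite g0; apply: filterI.
  have [e e01 He] := within_unit_near0 (cg i) nUG.
  exists e; split=> // u u01 ue; have [? [_ Gu]] := He u u01 ue.
  by split=> //; apply: Gu; right; exists i; exists u.
have e01 i : 0 < e i <= 1 by have [] := He i.
have eP i t : t \in `[0, 1]%R -> e i * t \in `[0, 1]%R /\ e i * t <= e i.
  rewrite !in_itv /= => /andP[t0 t1]; have /andP[ei0 ei1] := e01 i.
  by rewrite mulr_ge0 ?mulr_ile1 ?ler_piMr // ltW.
exists (fun i t => gamma i (e i * t)); last first.
  by move=> i t t01; have [_ H] := He i; have [? ?] := eP i t t01; apply: H.
split.
- by move=> i; apply: shrink_arc_continuous.
- move=> i t u; rewrite !inE => t01 u01 /ig.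
  rewrite !inE => /(_ (proj1 (eP i t t01)) (proj1 (eP i u u01))).
  by apply: mulfI; have /andP[/gt_eqF ->] := e01 i.
- by move=> i; rewrite mulr0.
- move=> i j ij; apply/seteqP; split=> z.
    move=> [[t t01 tz] [u u01 uz]]; rewrite -(dg i j ij); split.
      by exists (e i * t) => //; apply: (proj1 (eP i t t01)).
    by exists (e j * u) => //; apply: (proj1 (eP j u u01)).
  have z01 : `[0, 1]%classic (0 : R) by rewrite /= in_itv /= lexx ler01.
  by move=> ->; split; exists 0 => //; rewrite mulr0 g0.
- have z01 : (0 : R) \in `[0, 1]%R by rewrite in_itv /= lexx ler01.
  have : \forall z \near v, forall i u, u \in `[0, 1]%R -> gamma i u = z ->
      `|u| < e i.
    apply: filter_forall => i; have /andP[ei0 _] := e01 i.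
    have := arc_inverse_continuous hT (cg i) (@ig i) z01 ei0.
    rewrite g0; apply: filterS => z Hz u u01 uz.
    by rewrite -normrN -sub0r; apply: Hz.
  apply: filterS2 Gg => z Gz Hz; rewrite Gz; split=> -[->|[i [t t01 tz]]].
  + by left.
  + right; exists i; exists (t / e i); last first.
      by rewrite mulrCA mulfV ?mulr1 //; have /andP[/gt_eqF ->] := e01 i.
    have := Hz i t t01 tz; move: t01; rewrite /= !in_itv /= => /andP[t0 t1].
    have /andP[ei0 _] := e01 i.
    rewrite ger0_norm // => te; rewrite divr_ge0 ?(ltW ei0) //=.
    by rewrite ler_pdivrMr // mul1r ltW.
  + by left.
  + by right; exists i; exists (e i * t) => //; apply: (proj1 (eP i t t01)).
Qed.

(** Vertex degrees are local and topological: the arcs can be shrunk into U and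
    then mapped by f. *)
Lemma star_degree_transfer (T T' : topologicalType) (f : T -> T') (G U : set T)
    (G' : set T') (v : T) (k : nat) :
  hausdorff_space T -> open U -> U v ->
  (forall x, U x -> {for x, continuous f}) -> {in U &, injective f} ->
  (forall N, nbhs v N -> nbhs (f v) (f @` N)) ->
  (forall x, U x -> G' (f x) <-> G x) ->
  star_degree G v k -> star_degree G' (f v) k.
Proof.
move=> hT oU Uv cf injf openf GG' [gamma0 sg0].
have nU : nbhs v U by apply: open_nbhs_nbhs.
have [gamma [cg ig g0 dg Gg] gU] := star_shrink hT sg0 nU.
exists (fun i t => f (gamma i t)); split.
- move=> i; apply/subspace_continuousP => t t01.
  have /subspace_continuousP/(_ _ t01) git := cg i.
  exact: cvg_comp git (cf _ (proj1 (gU i t t01))).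
- move=> i t u; rewrite !inE => t01 u01 /injf.
  rewrite !inE => /(_ (proj1 (gU i t t01)) (proj1 (gU i u u01))) /ig.
  by rewrite !inE; apply.
- by move=> i; rewrite g0.
- move=> i j ij; apply/seteqP; split=> z.
    move=> [[t t01 <-] [u u01]] /injf; rewrite !inE.
    move=> /(_ (proj1 (gU j u u01)) (proj1 (gU i t t01))) E.
    suff -> : gamma i t = v by [].
    by rewrite -[_ = v]/([set v] _) -(dg i j ij); split; [exists t|exists u].
  have z01 : `[0, 1]%classic (0 : R) by rewrite /= in_itv /= lexx ler01.
  by move=> ->; split; exists 0 => //; rewrite g0.
- apply: filterS (openf _ (filterI nU Gg)) => _ [x [Ux Gx] <-].
  rewrite GG' // Gx; split=> -[E|[i [t t01 tx]]].
  + by left; rewrite E.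
  + by right; exists i; exists t => //; rewrite tx.
  + by left; apply: injf; rewrite ?inE.
  + right; exists i; exists t => //; apply: injf; rewrite ?inE //.
    by have [] := gU i t t01.
Qed.

(** A continuous real function that is locally injective is monotone near each
    point, so it has no interior extremum. *)
Lemma locally_injective_neq (g : R -> R) (a b : R) : a < b ->
  {within `[a, b], continuous g} ->
  (forall c, c \in `]a, b[%R -> exists2 d, 0 < d &
     forall x y, x \in `[a, b]%R -> y \in `[a, b]%R -> `|c - x| < d ->
       `|c - y| < d -> g x = g y -> x = y) ->
  g a != g b.
Proof.
move=> ab cg linj; apply/eqP => gab.
have noext c : c \in `]a, b[%R ->
    (forall t, t \in `[a, b]%R -> g t <= g c) \/
    (forall t, t \in `[a, b]%R -> g c <= g t) -> False.
  move=> cab ext; have [d d0 Hd] := linj c cab.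
  have [ca cb] : a < c /\ c < b by move: cab; rewrite in_itv => /andP.
  pose m := Num.min (d / 2) (Num.min (c - a) (b - c)).
  have m0 : 0 < m by rewrite !lt_min divr_gt0 // !subr_gt0 ca cb.
  have md : m < d by rewrite gt_min ltr_pdivrMr // ltr_pMr // ltr1n.
  have mca : m <= c - a by rewrite !ge_min lexx orbT.
  have mcb : m <= b - c by rewrite !ge_min lexx !orbT.
  have sub x : x \in `[c - m, c + m]%R -> x \in `[a, b]%R /\ `|c - x| < d.
    rewrite !in_itv /= => /andP[x1 x2]; split; first by apply/andP; split; lra.
    by rewrite ltr_norml; apply/andP; split; lra.
  have cgm : {within `[c - m, c + m], continuous g}.
    by apply: continuous_subspaceW cg => x /sub[].
  have injm : {in `[c - m, c + m]%R &, injective g}.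
    by move=> x y /sub[? ?] /sub[? ?]; apply: Hd.
  have i1 : c - m \in `[c - m, c + m]%R by rewrite in_itv /=; apply/andP; split; lra.
  have i2 : c + m \in `[c - m, c + m]%R by rewrite in_itv /=; apply/andP; split; lra.
  have i3 : c \in `[c - m, c + m]%R by rewrite in_itv /=; apply/andP; split; lra.
  have [j1 _] := sub _ i1; have [j2 _] := sub _ i2.
  have [lt1 lt2] : c - m < c /\ c < c + m by split; lra.
  have [mono|mono] := itv_continuous_inj_mono cgm injm.
    by have l1 := mono _ _ i1 i3 lt1; have l2 := mono _ _ i3 i2 lt2;
       case: ext => ext; have e1 := ext _ j1; have e2 := ext _ j2; lra.
  by have l1 := mono _ _ i3 i1 lt1; have l2 := mono _ _ i2 i3 lt2;
     case: ext => ext; have e1 := ext _ j1; have e2 := ext _ j2; lra.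
have [c cab cmax] := EVT_max (ltW ab) cg.
have [d dab dmin] := EVT_min (ltW ab) cg.
have endpt x : x \in `[a, b]%R -> x \notin `]a, b[%R -> g x = g a.
  rewrite !in_itv /= negb_and -!leNgt => /andP[x1 x2] /orP[x3|x3].
    by congr g; lra.
  by rewrite gab; congr g; lra.
have [ci|/(endpt _ cab) gc] := boolP (c \in `]a, b[%R).
  by apply: (noext c) => //; left.
have [di|/(endpt _ dab) gd] := boolP (d \in `]a, b[%R).
  by apply: (noext d) => //; right.
apply: (noext ((a + b) / 2)); first by rewrite in_itv /=; apply/andP; split; lra.
left=> t tab; apply: le_trans (cmax t tab) _; rewrite gc -gd; apply: dmin.
by rewrite in_itv /=; apply/andP; split; lra.
Qed.

End Stars.
(** * Ramification changes vertex degrees *)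

Section BranchedCovers.
Variable R : realType.

(** A path in a punctured star cannot change arcs, since the punctured arcs are
    disjoint and closed. The parameter of its arc turns it into a real function,
    which is injective as soon as it is locally injective. *)
Lemma path_in_star_injective (T : topologicalType) (G : set T) (w : T) (k : nat)
    (alpha : 'I_k -> R -> T) (h : R -> T) :
  hausdorff_space T -> star G w alpha ->
  {within `]0, 1], continuous h} ->
  (forall t, t \in `]0, 1]%R ->
     h t <> w /\ exists j, (alpha j @` `[0, 1]) (h t)) ->
  (forall c, c \in `]0, 1]%R -> exists2 d, 0 < d &
     forall x y, x \in `]0, 1]%R -> y \in `]0, 1]%R -> `|c - x| < d ->
       `|c - y| < d -> h x = h y -> x = y) ->
  (exists j, forall t, t \in `]0, 1]%R -> (alpha j @` `[0, 1]) (h t)) /\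
  {in `]0, 1]%R &, injective h}.
Proof.
move=> hT [ca ia a0 da _] ch hG linj.
have [] := @connected_in_one_closed T k (fun j => alpha j @` `[0, 1]) (h @` `]0, 1]).
- move=> j; apply: compact_closed => //; apply: continuous_compact => //.
  exact: segment_compact.
- apply: connected_continuous_connected => //.
  by apply/connected_intervalP; exact: interval_is_interval.
- by exists (h 1); exists 1 => //=; rewrite in_itv /= ltr01 lexx.
- by move=> _ [t t01 <-]; have [] := hG t t01.
- move=> i j _ [t t01 <-] hi hj; apply: contrapT => /eqP ij.
  have [hw _] := hG t t01; apply: hw.
  by rewrite -[_ = w]/([set w] _) -(da i j ij).
move=> j jP; split; first by exists j => t t01; apply: jP; exists t.
have /choice[tau tauP] : forall t, exists u, t \in `]0, 1]%R ->
    u \in `[0, 1]%R /\ alpha j u = h t.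
  move=> t; have [t01|] := boolP (t \in `]0, 1]%R); last by exists 0.
  have [|u u01 ut] := jP (h t); first by exists t.
  by exists u.
have ctau : {within `]0, 1], continuous tau}.
  apply/subspace_continuousP => t t01; apply/cvgrPdist_lt => e e0.
  have [u01 ut] := tauP t t01.
  have := arc_inverse_continuous hT (ca j) (@ia j) u01 e0; rewrite ut => N.
  have /subspace_continuousP/(_ t t01 _ N) : continuous (h : subspace _ -> T) := ch.
  apply: (@filterS _ (nbhs t)) => s Hs s01.
  by have [us01 us] := tauP s s01; apply: Hs.
suff lt_inj x y : x \in `]0, 1]%R -> y \in `]0, 1]%R -> x < y -> h x <> h y.
  move=> x y x01 y01 hxy; have [xy|yx|//] := ltgtP x y.
    by case: (lt_inj x y).
  by case: (lt_inj y x).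
move=> x01 y01 xy hxy.
have sub s : s \in `[x, y]%R -> s \in `]0, 1]%R.
  move: x01 y01; rewrite !in_itv /= => /andP[? ?] /andP[? ?] /andP[? ?].
  by apply/andP; split; lra.
have /eqP[] : tau x != tau y; last first.
  have [ux aux] := tauP x x01; have [uy auy] := tauP y y01.
  by apply: (@ia j); rewrite ?inE // aux auy.
apply: locally_injective_neq => //.
  by apply: continuous_subspaceW ctau => s /sub.
move=> c cxy; have [|d d0 Hd] := linj c.
  by apply: sub; move: cxy; rewrite !in_itv /= => /andP[? ?]; apply/andP; split; lra.
exists d => // s t /sub s01 /sub t01 cs ct tst; apply: (Hd s t) => //.
have [_ <-] := tauP s s01; have [_ <-] := tauP t t01; by rewrite tst.
Qed.

(** Every arc at v is mapped injectively into one arc at f v, so it contains at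
    most one preimage of a given point. A point close to f v on each of the k + 1
    arcs at f v has two preimages close to v, and these 2 (k + 1) points would
    have to lie on k + 1 arcs at v, no two of them on the same arc. *)
Lemma star_degree_branched (T T' : topologicalType) (f : T -> T') (G U : set T)
    (G' : set T') (v : T) (k : nat) :
  hausdorff_space T -> hausdorff_space T' -> open U -> U v ->
  (forall x, U x -> {for x, continuous f}) ->
  (forall x, U x -> f x = f v -> x = v) ->
  (forall x, U x -> x <> v -> exists2 N, nbhs x N & {in N &, injective f}) ->
  (forall x, U x -> G' (f x) <-> G x) ->
  (forall N, nbhs v N -> \forall w \near f v, w <> f v ->
     exists a b, [/\ N a, N b, a <> b, f a = w & f b = w]) ->
  star_degree R G' (f v) k.+1 -> ~ star_degree R G v k.+1.
Proof.
move=> hT hT' oU Uv cf fv linj GG' two [alpha sa] [gamma0 sg0].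
have [ca ia a0 da Ga] := sa.
have nU : nbhs v U by apply: open_nbhs_nbhs.
have nV : nbhs v (U `&` f @^-1` [set z | G' z <->
      z = f v \/ exists i, (alpha i @` `[0, 1]) z]).
  by apply: filterI => //; apply: (cf v Uv).
have [gamma sg gU] := star_shrink hT sg0 nV.
have [cg ig g0 dg Gg] := sg.
have i01 (t : R) : t \in `]0, 1]%R -> t \in `[0, 1]%R.
  by rewrite !in_itv /= => /andP[/ltW -> ->].
have z01 : (0 : R) \in `[0, 1]%R by rewrite in_itv /= lexx ler01.
have gv i t : t \in `]0, 1]%R -> gamma i t <> v.
  move=> t01 gtv; have := @ig i t 0; rewrite !inE g0.
  move=> /(_ (i01 t t01) z01 gtv) t0.
  by move: t01; rewrite t0 in_itv /= ltxx.
have cgf i : {within `]0, 1], continuous (f \o gamma i)}.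
  suff : {within `[0, 1], continuous (f \o gamma i)}.
    by apply: continuous_subspaceW => t; apply: i01.
  apply/subspace_continuousP => t t01.
  have /subspace_continuousP/(_ _ t01) git := cg i.
  by have [[Ut _] _] := gU i t t01; exact: cvg_comp git (cf _ Ut).
have inj i : (exists j, forall t, t \in `]0, 1]%R ->
      (alpha j @` `[0, 1]) (f (gamma i t))) /\
    {in `]0, 1]%R &, injective (f \o gamma i)}.
  apply: (path_in_star_injective hT' sa (cgf i)) => t t01.
    have [[Ut G't] Gt] := gU i t (i01 t t01).
    have fgt : f (gamma i t) <> f v by move=> /(fv _ Ut); apply: gv.
    by split=> //; have /G't[|//] : G' (f (gamma i t)) by apply/GG'.
  have [[Ut _] _] := gU i t (i01 t t01).
  have [N Nt injN] := linj _ Ut (gv i t t01).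
  have [d d0 Hd] := within_near (cg i) (i01 t t01) Nt.
  exists d => // x y x01 y01 tx ty fxy; apply: (@ig i); rewrite ?inE; try exact: i01.
  by apply: injN => //; rewrite inE; apply: Hd => //; apply: i01.
have preim j : exists ab : T * T, [/\ ab.1 <> ab.2, f ab.1 = f ab.2,
    forall x, x = ab.1 \/ x = ab.2 ->
      exists i, exists2 t, t \in `]0, 1]%R & gamma i t = x &
    exists2 u, u \in `]0, 1]%R & f ab.1 = alpha j u].
  pose onG' := [set z | G' z <-> z = f v \/ exists i, (alpha i @` `[0, 1]) z].
  pose N := U `&` f @^-1` onG' `&`
    [set z | G z <-> z = v \/ exists i, (gamma i @` `[0, 1]) z].
  have nN : nbhs v N by apply: filterI.
  have nw : nbhs (alpha j 0) ([set w | w <> f v -> exists a b,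
      [/\ N a, N b, a <> b, f a = w & f b = w]] `&` onG').
    by rewrite a0; apply: filterI => //; apply: two.
  have [e /andP[e0 e1] He] := within_unit_near0 (ca j) nw.
  have e01 : e \in `[0, 1]%R by rewrite in_itv /= (ltW e0).
  have [+ Gae] := He e e01 (lexx e).
  have aef : alpha j e <> f v.
    rewrite -(a0 j) => /(@ia j); rewrite !inE => /(_ e01 z01) E.
    by rewrite E ltxx in e0.
  case=> // a [b [[[Ua _] Ga'] [[Ub _] Gb'] nab fa fb]].
  have G'e : G' (alpha j e) by apply/Gae; right; exists j; exists e.
  exists (a, b); split=> //=; first by rewrite fa fb.
    have on x : U x -> (G x <-> x = v \/ exists i, (gamma i @` `[0, 1]) x) ->
        f x = alpha j e -> exists i, exists2 t, t \in `]0, 1]%R & gamma i t = x.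
      move=> Ux Gx fx; have /Gx : G x by apply/GG' => //; rewrite fx.
      case=> [xv|[i [t t01 tx]]]; first by case: aef; rewrite -fx xv.
      exists i; exists t => //; move: t01; rewrite /= !in_itv /= lt_neqAle.
      move=> /andP[-> ->]; rewrite !andbT; apply/eqP => t0.
      by apply: aef; rewrite -fx -tx -t0 g0.
    by move=> x [] ->; apply: on.
  by exists e => //; rewrite in_itv /= e0.
have /choice[ab abP] := preim.
pose pt (p : 'I_k.+1 * bool) := if p.2 then (ab p.1).1 else (ab p.1).2.
have /choice[br brP] : forall p, exists i,
    exists2 t, t \in `]0, 1]%R & gamma i t = pt p.
  move=> [j c]; have [_ _ H _] := abP j.
  by apply: H; rewrite /pt /=; case: c; [left|right].
have fpt p : exists2 u, u \in `]0, 1]%R & f (pt p) = alpha p.1 u.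
  by have [_ E _ H] := abP p.1; rewrite /pt; case: p.2; rewrite -?E.
have br_inj : injective br.
  move=> p q pq; have [t t01 tp] := brP p; have [s s01 sq] := brP q.
  have [[j jP] injf] := inj (br p).
  have onj r : br r = br p -> r.1 = j.
    move=> rp; have [u u01 ur] := fpt r; have [t' t'01 tr] := brP r.
    apply: contrapT => /eqP rj; have [_ _ H _] := abP j.
    have [] : [set f v] (f (pt r)); last first.
    - move=> E; have := @ia r.1 u 0; rewrite !inE a0 -ur.
      move=> /(_ (i01 _ u01) z01 E) u0.
      by move: u01; rewrite u0 in_itv /= ltxx.
    rewrite -(da r.1 j rj); split; first by exists u => //; apply: i01.
    by rewrite -tr rp; apply: jP.
  have pq1 : p.1 = q.1 by rewrite (onj p) // (onj q).
  have pq2 : p.2 = q.2.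
    have [nab fab _ _] := abP p.1.
    apply: contrapT => npq; apply: nab.
    have : pt p = pt q.
      rewrite -tp -sq -pq; congr gamma; apply: injf => //=.
      rewrite pq sq -pq tp /pt -pq1; move: fab.
      by case: p.2; case: q.2.
    by rewrite /pt -pq1; move: npq; case: p.2; case: q.2.
  by rewrite [p]surjective_pairing [q]surjective_pairing pq1 pq2.
have := leq_card br br_inj.
by rewrite card_prod card_bool card_ord muln2 -addnn -[leqRHS]addn0 leq_add2l.
Qed.

End BranchedCovers.

(** * Roots of polynomials near a multiple root *)

Section RootsNearZero.
Variable K : numClosedFieldType.
Implicit Types (f h : {poly K}) (r : K).

(** The ratio of the coefficients of degrees i and 0 is, up to sign, the i-th
    elementary symmetric function of the inverses of the roots. The leading
    coefficient does not enter, so the bound is insensitive to roots that escape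
    to infinity. *)
Lemma coef_bound_of_far_roots (s : seq K) r (i : nat) :
  0 < r -> (forall a, a \in s -> r <= `|a|) ->
  `|(\prod_(a <- s) ('X - a%:P))`_i| * r ^+ i <=
  2 ^+ size s * `|(\prod_(a <- s) ('X - a%:P))`_0|.
Proof.
move=> r0; elim: s i => [|a s IH] i far.
  rewrite big_nil !coef1 expr0 mul1r; case: i => [|i]; rewrite ?mulr1 //.
  by rewrite normr0 mul0r normr1.
have ra : r <= `|a| by apply: far; rewrite mem_head.
have {}IH := IH _ (fun b bs => far b (@mem_behead _ (a :: s) b bs)).
rewrite big_cons mulrBl !coefB !coefCM !coefXM /= sub0r normrN.
rewrite [in leRHS]normrM; set p := \prod_(b <- s) _ in IH *.
have IHa j : `|a| * (`|p`_j| * r ^+ j) <= `|a| * (2 ^+ size s * `|p`_0|).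
  by rewrite ler_wpM2l.
have pB : 0 <= 2 ^+ size s * `|p`_0| by rewrite mulr_ge0 // exprn_ge0.
apply: le_trans (_ : `|a| * (2 ^+ size s * `|p`_0|) +
                     `|a| * (2 ^+ size s * `|p`_0|) <= _); last first.
  by rewrite le_eqVlt /= exprS; apply/orP; left; apply/eqP; ring.
apply: le_trans (ler_wpM2r _ (ler_normB _ _)) _; first by rewrite exprn_ge0 // ltW.
rewrite mulrDl lerD //; last by rewrite normrM -mulrA.
case: i => [|i] /=; first by rewrite normr0 mul0r mulr_ge0.
by rewrite exprS mulrCA (le_trans _ (ler_wpM2r pB ra)) // ler_wpM2l // ltW.
Qed.

Lemma root_or_coef_bound f r (N : nat) : f != 0 -> 0 < r -> (size f <= N.+1)%N ->
  (exists2 a, root f a & `|a| < r) \/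
  forall i, `|f`_i| * r ^+ i <= 2 ^+ N * `|f`_0|.
Proof.
move=> f0 r0 sf; have [s fE] := closed_field_poly_normal f.
have [/hasP[a as_ ar]|/hasPn far] := boolP (has (fun a => `|a| < r) s).
  left; exists a => //; rewrite fE rootZ ?lead_coef_eq0 //.
  by rewrite root_prod_XsubC.
right=> i; rewrite fE !coefZ !normrM -mulrA [leRHS]mulrCA ler_wpM2l //.
have ss : (size s <= N)%N.
  by move: sf; rewrite fE size_scale ?lead_coef_eq0 // size_prod_XsubC.
apply: le_trans (_ : _ <= 2 ^+ size s * _) _.
  apply: coef_bound_of_far_roots => // a /far.
  by rewrite -real_leNgt // ?normr_real // gtr0_real.
by rewrite ler_wpM2r // ler_eXn2l // ltr1n.
Qed.

Lemma root_near0 f r (N m : nat) : 0 < r -> (size f <= N.+1)%N ->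
  2 ^+ N * `|f`_0| < `|f`_m| * r ^+ m -> exists2 a, root f a & `|a| < r.
Proof.
move=> r0 sf fm; have f0 : f != 0.
  by apply: contraTneq fm => ->; rewrite !coef0 normr0 mulr0 mul0r ltxx.
have [//|/(_ m)] := root_or_coef_bound f0 r0 sf.
by rewrite (lt_geF fm).
Qed.

(** Divide f by X - a for a root a very close to 0. The constant coefficient of
    the quotient is close to the coefficient of degree 1 of f, hence too small for
    the quotient to have all its roots far from 0. *)
Lemma two_roots_near0 f r (N m : nat) : 0 < r <= 1 -> (size f <= N.+1)%N ->
  2 ^+ N * `|f`_0| < `|f`_m.+1| * (r / 2 ^+ N.+1) ^+ m.+1 ->
  2 ^+ N.+2 * `|f`_1| < `|f`_m.+1| * r ^+ m.+1 ->
  exists a b h, [/\ f = ('X - a%:P) * ('X - b%:P) * h, `|a| < r & `|b| < r].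
Proof.
move=> /andP[r0 r1] sf f0m f1m.
have p2 k : 0 < 2 ^+ k :> K by rewrite exprn_gt0.
have rho0 : 0 < r / 2 ^+ N.+1 by rewrite divr_gt0.
have rho_r : r / 2 ^+ N.+1 <= r.
  by rewrite ler_pdivrMr // ler_pMr // exprn_ege1 // ler1n.
have [a /factor_theorem[h fE] ar] := root_near0 rho0 sf f0m.
have h0 : h != 0.
  by apply: contraTneq f0m => h0; rewrite fE h0 mul0r !coef0 normr0 mulr0 mul0r ltxx.
have sh : (size h <= N.+1)%N.
  by move: sf; rewrite fE size_Mmonic ?monicXsubC // size_XsubC addnC /= => /ltnW.
have [[b /factor_theorem[h' hE] br]|hb] := root_or_coef_bound h0 r0 sh.
  exists a, b, h'; split=> //; last exact: lt_le_trans ar rho_r.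
  by rewrite fE hE mulrC mulrA mulrAC mulrC mulrA.
have fS k : f`_k.+1 = h`_k - a * h`_k.+1.
  by rewrite fE mulrBr coefB coefMX coefMC /= [a * _]mulrC.
have aN : `|a| * 2 ^+ N.+1 <= r by rewrite -ler_pdivlMr // ltW.
have a1 : `|a| <= 1 by apply: ltW; apply: lt_le_trans ar (le_trans rho_r r1).
have ah1 : 2 * `|a * h`_1| <= `|h`_0|.
  rewrite -(ler_pM2l (p2 N)) (le_trans _ (hb 1%N)) // expr1 mulrA -exprSr.
  by rewrite normrM mulrA mulrC ler_wpM2l // mulrC.
have h0f1 : `|h`_0| <= 2 * `|f`_1|.
  have : 2 * `|h`_0| <= 2 * `|f`_1| + `|h`_0|.
    apply: le_trans (_ : _ <= 2 * (`|f`_1| + `|a * h`_1|)) _.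
      by rewrite ler_pM2l // (le_trans _ (ler_normD _ _)) // fS subrK.
    by rewrite mulrDr lerD2l.
  by rewrite [2 * `|h`_0|]mulr_natl mulr2n lerD2r.
suff : `|f`_m.+1| * r ^+ m.+1 <= 2 ^+ N.+2 * `|f`_1| by rewrite (lt_geF f1m).
have hN : 0 <= 2 ^+ N * `|h`_0| by rewrite mulr_ge0 // ltW.
apply: le_trans (_ : _ <= 2 ^+ N * `|h`_0| + 2 ^+ N * `|h`_0|) _.
  rewrite fS (le_trans (ler_wpM2r _ (ler_normB _ _))) ?exprn_ge0 ?(ltW r0) //.
  rewrite mulrDl lerD //.
    rewrite exprSr mulrA (le_trans _ (hb m)) // ler_piMr //.
    by rewrite mulr_ge0 // exprn_ge0 // ltW.
  rewrite normrM -mulrA (le_trans _ (hb m.+1)) // ler_piMl //.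
  by rewrite mulr_ge0 // exprn_ge0 // ltW.
have -> : 2 ^+ N.+2 * `|f`_1| = 2 ^+ N * (2 * `|f`_1|) + 2 ^+ N * (2 * `|f`_1|).
  by rewrite !exprS; ring.
by rewrite lerD // ler_pM2l.
Qed.

End RootsNearZero.

(** * Local behaviour of a quotient of two polynomials *)

Section Polynomials.
Variable R : realType.
Local Notation C := R[i].
Implicit Types (p P Q : {poly C}).

Lemma cvgXn (T : Type) (F : set_system T) (f : T -> C) (a : C) (n : nat) :
  Filter F -> f @ F --> a -> (f t ^+ n) @[t --> F] --> a ^+ n.
Proof.
move=> FF fa; elim: n => [|n IH]; first by under eq_fun do rewrite expr0; exact: cvg_cst.
have -> : (fun t => f t ^+ n.+1) = (fun t => f t * f t ^+ n).
  by apply/funext => t; rewrite exprS.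
by rewrite exprS; exact: (cvgM fa IH).
Qed.

Lemma cvg_horner (T : Type) (F : set_system T) (h : T -> {poly C}) (f : T -> C)
    (p : {poly C}) (a : C) (N : nat) : Filter F ->
  (forall t, (size (h t) <= N)%N) -> (size p <= N)%N ->
  (forall i, (h t)`_i @[t --> F] --> p`_i) -> f @ F --> a ->
  (h t).[f t] @[t --> F] --> p.[a].
Proof.
move=> FF sh sp hp fa; rewrite (horner_coef_wide _ sp).
under eq_fun do rewrite (horner_coef_wide _ (sh _)).
apply: cvg_big => [|i _]; first exact: add_continuous.
exact: (cvgM (hp i) (cvgXn (n := i) FF fa)).
Qed.

Lemma cvg_hornerT (T : Type) (F : set_system T) (f : T -> C) p (a : C) :
  Filter F -> f @ F --> a -> p.[f t] @[t --> F] --> p.[a].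
Proof.
move=> FF fa; have cp i : (p : {poly C})`_i @[_ --> F] --> p`_i by exact: cvg_cst.
exact: (@cvg_horner T F (fun=> p) f p a (size p) FF).
Qed.

Lemma horner_continuous p : continuous (fun x : C => p.[x]).
Proof.
move=> x; have FF : Filter (nbhs x) := nbhs_filter x.
exact: (@cvg_hornerT _ (nbhs x) id p x FF cvg_id).
Qed.

(** The continuous extension to the diagonal of (p.[x] - p.[y]) / (x - y). *)
Definition divdiff p (x y : C) : C :=
  \sum_(i < size p) p`_i * \sum_(j < i) x ^+ (i.-1 - j) * y ^+ j.

Lemma hornerB_divdiff p x y : p.[x] - p.[y] = (x - y) * divdiff p x y.
Proof.
rewrite !horner_coef -sumrB mulr_sumr; apply: eq_bigr => i _.
rewrite -mulrBr mulrCA; congr (_ * _); case: (val i) => [|k].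
  by rewrite !expr0 subrr big_ord0 mulr0.
by rewrite subrXX; congr (_ * _); apply: eq_bigr => j _; rewrite subSS.
Qed.

Lemma cvg_divdiff (T : Type) (F : set_system T) (f g : T -> C) p (a b : C) :
  Filter F -> f @ F --> a -> g @ F --> b ->
  divdiff p (f t) (g t) @[t --> F] --> divdiff p a b.
Proof.
move=> FF fa gb; apply: cvg_big => [|i _]; first exact: add_continuous.
have inner : \sum_(j < i) f t ^+ (i.-1 - j) * g t ^+ j @[t --> F] -->
    \sum_(j < i) a ^+ (i.-1 - j) * b ^+ j.
  apply: cvg_big => [|j _]; first exact: add_continuous.
  exact: (cvgM (cvgXn FF fa) (cvgXn FF gb)).
exact: (cvgM (cvg_cst _) inner).
Qed.

Lemma divdiff_diag p c : divdiff p c c = p^`().[c].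
Proof.
rewrite [RHS](@horner_coef_wide _ (size p).-1) ?size_poly //.
rewrite /divdiff; case: (size p) => [|k]; first by rewrite !big_ord0.
rewrite big_ord_recl big_ord0 mulr0 add0r; apply: eq_bigr => i _ /=.
rewrite coef_deriv mulrnAl -mulrnAr; congr (_ * _).
rewrite (eq_bigr (fun=> c ^+ i)) => [|j _].
  by rewrite sumr_const card_ord.
by rewrite -exprD subnK // -ltnS.
Qed.

(** The numerator of the derivative of P / Q. Being alternating in P and Q, it
    tests ramification of P / Q at poles as well. *)
Definition wronskian P Q := P^`() * Q - P * Q^`().

Definition quotient_slope P Q (x y : C) : C :=
  (divdiff P x y * Q.[y] - P.[y] * divdiff Q x y) / (Q.[x] * Q.[y]).

Lemma quotientB_slope P Q x y : Q.[x] != 0 -> Q.[y] != 0 ->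
  P.[x] / Q.[x] - P.[y] / Q.[y] = (x - y) * quotient_slope P Q x y.
Proof.
move=> Qx Qy; have PE := hornerB_divdiff P x y; have QE := hornerB_divdiff Q x y.
transitivity (((P.[x] - P.[y]) * Q.[y] - P.[y] * (Q.[x] - Q.[y])) / (Q.[x] * Q.[y])).
  by field; rewrite Qx Qy.
by rewrite PE QE /quotient_slope [RHS]mulrA; congr (_ / _); ring.
Qed.

Lemma cvg_quotient_slope (T : Type) (F : set_system T) (f g : T -> C) P Q (c : C) :
  Filter F -> Q.[c] != 0 -> f @ F --> c -> g @ F --> c ->
  quotient_slope P Q (f t) (g t) @[t --> F] -->
    (wronskian P Q).[c] / Q.[c] ^+ 2.
Proof.
move=> FF Qc fc gc.
have -> : (wronskian P Q).[c] / Q.[c] ^+ 2 = quotient_slope P Q c c.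
  by rewrite /quotient_slope !divdiff_diag /wronskian !hornerE expr2.
have dd p := cvg_divdiff (p := p) FF fc gc.
have hf p := cvg_hornerT (p := p) FF fc.
have hg p := cvg_hornerT (p := p) FF gc.
exact: (cvgM (cvgB (cvgM (dd P) (hg Q)) (cvgM (hg P) (dd Q)))
  (cvgV (mulf_neq0 Qc Qc) (cvgM (hf Q) (hg Q)))).
Qed.

Lemma nonroot_near Q (c : C) : Q.[c] != 0 -> \forall t \near c, Q.[t] != 0.
Proof. by move=> Qc; exact: (cvgr_neq0 _ (@horner_continuous Q c) Qc). Qed.

Lemma polyfrac_continuous P Q (c : C) : Q.[c] != 0 ->
  {for c, continuous (fun t => P.[t] / Q.[t])}.
Proof.
move=> Qc; have Pc := @horner_continuous P c; have Qcont := @horner_continuous Q c.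
exact: (cvgM Pc (cvgV Qc Qcont)).
Qed.

Lemma polyfrac_near P Q (c : C) (N : set C) : Q.[c] != 0 ->
  nbhs (P.[c] / Q.[c]) N -> nbhs c ((fun t => P.[t] / Q.[t]) @^-1` N).
Proof.
move=> Qc nN; have := @polyfrac_continuous P Q c Qc.
by rewrite /prop_for /continuous_at => /(_ N nN).
Qed.

(** Where the Wronskian does not vanish, the slopes of secants near the diagonal
    are bounded away from zero. *)
Lemma quotient_expanding P Q (c : C) :
  Q.[c] != 0 -> (wronskian P Q).[c] != 0 ->
  exists m d : C, [/\ 0 < m, 0 < d & forall x y, ball c d x -> ball c d y ->
    m * `|x - y| <= `|P.[x] / Q.[x] - P.[y] / Q.[y]|].
Proof.
move=> Qc Wc; set s := (wronskian P Q).[c] / Q.[c] ^+ 2.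
have s0 : 0 < `|s| by rewrite normr_gt0 mulf_neq0 // invr_eq0 expf_neq0.
have : \forall z \near (c, c), [/\ Q.[z.1] != 0, Q.[z.2] != 0 &
    `|s| / 2 < `|quotient_slope P Q z.1 z.2|].
  have FF : Filter (nbhs (c, c)) := nbhs_filter (c, c).
  have fc : (fun z : C * C => z.1) @ nbhs (c, c) --> c by exact: cvg_fst.
  have gc : (fun z : C * C => z.2) @ nbhs (c, c) --> c by exact: cvg_snd.
  have sc := cvg_quotient_slope (P := P) FF Qc fc gc.
  have Qfc := cvg_hornerT (p := Q) FF fc.
  have Qgc := cvg_hornerT (p := Q) FF gc.
  near=> z; split.
  + by near: z; exact: (cvgr_neq0 _ Qfc Qc).
  + by near: z; exact: (cvgr_neq0 _ Qgc Qc).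
  + near: z; apply: (cvgr_norm_gt _ sc); rewrite ltr_pdivrMr //.
    by rewrite ltr_pMr // ltr1n.
case=> -[A B] /= [nA nB] AB.
have /nbhs_ballP[d /= d0 dAB] : nbhs c (A `&` B) by apply: filterI.
exists (`|s| / 2), d; split; [by rewrite divr_gt0|by []|].
move=> x y /dAB[Ax _] /dAB[_ By]; have [|Qx Qy sxy] := AB (x, y); first by [].
by rewrite quotientB_slope // [leRHS]normrM [leLHS]mulrC ler_wpM2l // ltW.
Unshelve. all: by end_near. Qed.

End Polynomials.

Section QuotientsOfPolynomials.
Variable R : realType.
Local Notation C := R[i].
Implicit Types (p P Q : {poly C}).

Lemma punctured_nonroot_near p : p != 0 ->
  \forall t \near (0 : C), t != 0 -> p.[t] != 0.
Proof.
move=> p0; have [k [q /implyP/(_ p0) q0 ->]] := multiplicity_XsubC p 0.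
apply: filterS (nonroot_near q0) => t qt t0.
by rewrite !hornerE mulf_neq0 // expf_neq0 // subr0.
Qed.

(** The hypotheses of the root estimates hold for P - z Q when z is close to w:
    the coefficient k tends to 0 but the coefficient m does not. *)
Lemma pencil_coef_near P Q (w e : C) (k m : nat) : 0 < e ->
  (P - w *: Q)`_k = 0 -> (P - w *: Q)`_m != 0 ->
  \forall z \near w, `|(P - z *: Q)`_k| < `|(P - z *: Q)`_m| * e.
Proof.
move=> e0; set s := (P - w *: Q)`_m => Ek sm.
have coefc i : (P - z *: Q)`_i @[z --> w] --> (P - w *: Q)`_i.
  under eq_fun do rewrite coefB coefZ; rewrite coefB coefZ.
  have cst (u : C) : (fun=> u) @ nbhs w --> u by exact: cvg_cst.
  have idw : id @ nbhs w --> w by exact: cvg_id.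
  exact: (cvgB (cst P`_i) (cvgM idw (cst Q`_i))).
have s0 : 0 < `|s| by rewrite normr_gt0.
near=> z; apply: (@lt_trans _ _ (`|s| / 2 * e)).
  near: z; apply: (cvgr_norm_lt _ (coefc k)).
  by rewrite Ek normr0 mulr_gt0 // divr_gt0.
rewrite ltr_pM2r //; near: z; apply: (cvgr_norm_gt _ (coefc m)).
by rewrite ltr_pdivrMr // ltr_pMr // ltr1n.
Unshelve. all: by end_near. Qed.

Lemma size_pencil P Q (w : C) :
  (size (P - w *: Q)%R <= (maxn (size P) (size Q)).+1)%N.
Proof.
rewrite (leq_trans (size_polyD _ _)) // size_polyN (leq_trans _ (leqnSn _)) //.
by rewrite geq_max leq_maxl (leq_trans (size_scale_leq _ _)) ?leq_maxr.
Qed.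

Lemma wronskian_pencil P Q (w : C) : wronskian (P - w *: Q) Q = wronskian P Q.
Proof.
rewrite /wronskian derivB derivZ mulrBl mulrBl -!scalerAl [Q * _]mulrC.
by rewrite opprB addrA subrK.
Qed.

Lemma pencil_coef0 P Q : Q.[0] != 0 -> (P - (P.[0] / Q.[0]) *: Q)`_0 = 0.
Proof. by move=> Q0; rewrite -horner_coef0 !hornerE divfK // subrr. Qed.

Lemma pencil_coef1 P Q : Q.[0] != 0 ->
  (P - (P.[0] / Q.[0]) *: Q)`_1 = (wronskian P Q).[0] / Q.[0].
Proof.
move=> Q0; rewrite -(wronskian_pencil _ _ (P.[0] / Q.[0])).
have := pencil_coef0 P Q0; move: (P - _) => f; rewrite -horner_coef0 => f0.
rewrite /wronskian !hornerE f0 mul0r subr0 mulfK //.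
by rewrite horner_coef0 coef_deriv.
Qed.

(** P - w Q has a root close to 0, because its coefficient of degree 0 tends to 0
    while that of degree 1 tends to a nonzero multiple of the Wronskian. *)
Lemma quotient_surjective_near P Q (N : set C) :
  Q.[0] != 0 -> (wronskian P Q).[0] != 0 -> nbhs (0 : C) N ->
  \forall w \near P.[0] / Q.[0], exists2 t, N t & P.[t] / Q.[t] = w.
Proof.
move=> Q0 W0 nN.
have /nbhs_ballP[r /= r0 rN] : nbhs (0 : C) (N `&` [set t | Q.[t] != 0]).
  by apply: filterI => //; exact: nonroot_near.
set w0 := P.[0] / Q.[0]; pose n := maxn (size P) (size Q).
have p2 : 0 < 2 ^+ n :> C by rewrite exprn_gt0.
have e0 : 0 < r / 2 ^+ n by rewrite divr_gt0.
have c1 : (P - w0 *: Q)`_1 != 0.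
  by rewrite pencil_coef1 // mulf_neq0 // invr_eq0.
apply: filterS (pencil_coef_near e0 (pencil_coef0 P Q0) c1) => w.
rewrite mulrA ltr_pdivlMr // mulrC => /root_near0[//||t].
  exact: size_pencil.
move=> /rootP; rewrite !hornerE => /eqP; rewrite subr_eq0 => /eqP Pt tr.
have [|Nt Qt] := rN t; first by rewrite /ball /= sub0r normrN.
by exists t => //; rewrite Pt mulfK.
Qed.

(** The local inverse of P / Q exists by [quotient_surjective_near] and is
    Lipschitz by [quotient_expanding]. *)
Lemma star_degree_unramified P Q (S : set C) (k : nat) :
  Q.[0] != 0 -> (wronskian P Q).[0] != 0 ->
  star_degree R S (P.[0] / Q.[0]) k ->
  star_degree R [set t | S (P.[t] / Q.[t])] (0 : C) k.
Proof.
move=> Q0 W0 stS; set f := fun t => P.[t] / Q.[t].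
have [m [d [m0 d0 fexp]]] := quotient_expanding Q0 W0.
have finj x y : ball (0 : C) d x -> ball (0 : C) d y -> f x = f y -> x = y.
  move=> dx dy fxy; have := fexp x y dx dy; rewrite -!/(f _) fxy subrr normr0.
  by rewrite pmulr_rle0 // normr_le0 subr_eq0 => /eqP.
have b0 : ball (0 : C) d 0 by exact: ballxx.
have := quotient_surjective_near Q0 W0 (nbhsx_ballx (0 : C) d d0).
move=> /nbhs_ballP[e /= e0 sur].
have /choice[s sP] : forall w, exists t,
    ball (P.[0] / Q.[0]) e w -> ball (0 : C) d t /\ f t = w.
  move=> w; have [/sur[t ? ?]|nb] := pselect (ball (P.[0] / Q.[0]) e w).
    by exists t.
  by exists 0.
have c0 : ball (P.[0] / Q.[0]) e (P.[0] / Q.[0]) by exact: ballxx.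
have s0 : s (P.[0] / Q.[0]) = 0.
  by have [ds fs] := sP _ c0; apply: finj.
rewrite -s0; apply: (star_degree_transfer (U := ball (P.[0] / Q.[0]) e)) stS => //.
- exact: ball_open.
- move=> w wU; have FF : Filter (nbhs w) := nbhs_filter w.
  apply/(@cvgrPdist_lt _ _ _ (nbhs w) FF) => eps eps0.
  have : \forall z \near w, ball (P.[0] / Q.[0]) e z /\ `|w - z| < m * eps.
    apply: filterI.
      by apply: open_nbhs_nbhs; split => //; exact: ball_open.
    by apply: nbhsx_ballx; rewrite mulr_gt0.
  apply: filterS => z [zU wz]; have [dw fw] := sP w wU; have [dz fz] := sP z zU.
  rewrite -(ltr_pM2l m0) (le_lt_trans _ wz) // -[in leRHS]fw -[in leRHS]fz.
  exact: fexp.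
- move=> x y; rewrite !inE => xU yU sxy.
  by have [_ <-] := sP x xU; have [_ <-] := sP y yU; rewrite sxy.
- move=> N nN; rewrite s0.
  have nNU : nbhs (P.[0] / Q.[0]) (N `&` ball (P.[0] / Q.[0]) e).
    by apply: filterI => //; apply: nbhsx_ballx.
  have nf : nbhs (0 : C) (f @^-1` (N `&` ball (P.[0] / Q.[0]) e)).
    exact: polyfrac_near.
  apply: filterS (filterI nf (nbhsx_ballx (0 : C) d d0)) => t [[Nft Uft] dt].
  by exists (f t) => //; have [ds fs] := sP _ Uft; apply: finj.
- by move=> x xU; have [_ fsx] := sP x xU; rewrite /= -!/(f _) fsx.
Qed.

(** If f = P - (P / Q)(0) Q vanishes to the order m > 0 at 0, then the Wronskian,
    which is also that of f and Q, has the nonzero term m f_m Q_0 in degree m - 1. *)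
Lemma wronskian_neq0 P Q : Q.[0] != 0 -> P - (P.[0] / Q.[0]) *: Q != 0 ->
  wronskian P Q != 0.
Proof.
move=> Q0; rewrite -(wronskian_pencil _ _ (P.[0] / Q.[0])).
have f0 := pencil_coef0 P Q0; set f := P - _ in f0 *.
move=> fN0; have : exists m, f`_m != 0.
  by exists (size f).-1; rewrite -lead_coefE lead_coef_eq0.
move=> /ex_minnP[[|m] fm fmin]; first by rewrite f0 eqxx in fm.
have fsmall j : (j <= m)%N -> f`_j = 0.
  by move=> jm; apply/eqP; apply: contraTT jm => /fmin; rewrite -ltnNge.
apply/eqP => /(congr1 (fun p : {poly C} => p`_m)); rewrite coef0 coefB !coefM.
rewrite big_ord_recr big1 /= => [|j _]; last first.
  by rewrite coef_deriv fsmall ?mul0rn ?mul0r.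
rewrite big1 => [|j _]; last by rewrite fsmall ?mul0r // -ltnS.
rewrite subr0 add0r subnn -horner_coef0 coef_deriv => /eqP.
by rewrite mulf_eq0 (negPf Q0) orbF mulrn_eq0 (negPf fm).
Qed.

(** At a critical point, two roots of P - w Q merge when w tends to the critical
    value; they are distinct for other w since they are not critical. *)
Lemma two_preimages_near P Q (N : set C) : Q.[0] != 0 ->
  (wronskian P Q).[0] = 0 -> P - (P.[0] / Q.[0]) *: Q != 0 -> nbhs (0 : C) N ->
  \forall w \near P.[0] / Q.[0], w <> P.[0] / Q.[0] ->
     exists a b, [/\ N a, N b, a <> b, P.[a] / Q.[a] = w & P.[b] / Q.[b] = w].
Proof.
move=> Q0 W0 f0 nN.
have /nbhs_ballP[r1 /= r10 rN] : nbhs (0 : C) (N `&` [set t | Q.[t] != 0] `&`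
    [set t | t != 0 -> (wronskian P Q).[t] != 0]).
  have FF : Filter (nbhs (0 : C)) := nbhs_filter 0.
  have W := punctured_nonroot_near (wronskian_neq0 Q0 f0).
  exact: (filterI (filterI nN (nonroot_near Q0)) W).
have [r /andP[r0 rle1] rr1] : exists2 r : C, 0 < r <= 1 & r <= r1.
  exists (r1 / (1 + r1)).
    by rewrite divr_gt0 ?addr_gt0 //= ler_pdivrMr ?addr_gt0 // mul1r lerDr.
  by rewrite ler_pdivrMr ?addr_gt0 // ler_pMr // lerDl ltW.
set w0 := P.[0] / Q.[0]; pose n := maxn (size P) (size Q).
have c0 : (P - w0 *: Q)`_0 = 0 by exact: pencil_coef0.
have c1 : (P - w0 *: Q)`_1 = 0 by rewrite pencil_coef1 // W0 mul0r.
have [m cm] : exists m, (P - w0 *: Q)`_m.+1 != 0.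
  exists (size (P - w0 *: Q)).-2; case E : (size (P - w0 *: Q)) => [|[|k]] /=.
  - by move/eqP: E; rewrite size_poly_eq0 (negPf f0).
  - by move: f0; rewrite -lead_coef_eq0 lead_coefE E c0 eqxx.
  - by move: f0; rewrite -lead_coef_eq0 lead_coefE E.
have p2 k : 0 < 2 ^+ k :> C by rewrite exprn_gt0.
have e1 : 0 < (r / 2 ^+ n.+1) ^+ m.+1 / 2 ^+ n.
  by rewrite divr_gt0 // exprn_gt0 // divr_gt0.
have e2 : 0 < r ^+ m.+1 / 2 ^+ n.+2 by rewrite divr_gt0 // exprn_gt0.
apply: filterS2 (pencil_coef_near e1 c0 cm) (pencil_coef_near e2 c1 cm) => w.
rewrite !mulrA !ltr_pdivlMr // ![_ * 2 ^+ _]mulrC => H1 H2 ww0.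
have r01 : 0 < r <= 1 by rewrite r0 rle1.
have [a [b [h [fE ar br]]]] := two_roots_near0 r01 (size_pencil P Q w) H1 H2.
have inr x : `|x| < r -> ball (0 : C) r1 x.
  by move=> xr; rewrite /ball /= sub0r normrN (lt_le_trans xr).
have [[Na Qa] Wa] := rN a (inr a ar); have [[Nb Qb] _] := rN b (inr b br).
have val x : Q.[x] != 0 -> (P - w *: Q).[x] = 0 -> P.[x] / Q.[x] = w.
  rewrite !hornerE => Qx /eqP; rewrite subr_eq0 => /eqP ->; exact: mulfK.
have fa : P.[a] / Q.[a] = w by apply: val => //; rewrite fE !hornerE subrr !mul0r.
have fb : P.[b] / Q.[b] = w by apply: val => //; rewrite fE !hornerE subrr mulr0 mul0r.
exists a, b; split=> // ab; apply: ww0; rewrite -fa.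
suff -> : a = 0 by [].
apply/eqP; apply: contraT => /Wa; rewrite -(wronskian_pencil _ _ w) fE -ab.
by rewrite /wronskian !derivM !derivB !derivX !derivC !hornerE subrr !mul0r !mulr0
  ?mul0r ?addr0 ?subr0 ?mul0r eqxx.
Qed.

Lemma star_degree_ramified P Q (S : set C) (k : nat) :
  Q.[0] != 0 -> (wronskian P Q).[0] = 0 -> P - (P.[0] / Q.[0]) *: Q != 0 ->
  star_degree R S (P.[0] / Q.[0]) k.+1 ->
  ~ star_degree R [set t | S (P.[t] / Q.[t])] (0 : C) k.+1.
Proof.
move=> Q0 W0 f0; have W := wronskian_neq0 Q0 f0.
set f := fun t => P.[t] / Q.[t].
have /nbhs_ballP[r /= r0 rU] : nbhs (0 : C) ([set t | Q.[t] != 0] `&`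
    [set t | t != 0 -> (wronskian P Q).[t] != 0] `&`
    [set t | t != 0 -> (P - (P.[0] / Q.[0]) *: Q).[t] != 0]).
  have FF : Filter (nbhs (0 : C)) := nbhs_filter 0.
  exact: (filterI (filterI (nonroot_near Q0) (punctured_nonroot_near W))
    (punctured_nonroot_near f0)).
apply: (@star_degree_branched R _ _ f _ (ball (0 : C) r)).
- exact: norm_hausdorff.
- exact: norm_hausdorff.
- exact: ball_open.
- exact: ballxx.
- by move=> x /rU[[Qx _] _]; exact: polyfrac_continuous.
- move=> x /rU[[Qx _] fx] fx0; apply/eqP; apply: contraT => /fx.
  by rewrite !hornerE -/(f 0) -fx0 divfK // subrr eqxx.
- move=> x /rU[[Qx Wx] _] /eqP /Wx Wx0.
  have [m [d [m0 d0 fexp]]] := quotient_expanding Qx Wx0.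
  exists (ball x d); first exact: nbhsx_ballx.
  move=> y z; rewrite !inE => dy dz fyz; have := fexp y z dy dz.
  rewrite -!/(f _) fyz subrr normr0.
  by rewrite pmulr_rle0 // normr_le0 subr_eq0 => /eqP.
- by [].
- by move=> N nN; apply: two_preimages_near.
Qed.

End QuotientsOfPolynomials.

(** * Model stars: the complex numbers with nonnegative cube *)

Section CubeRays.
Local Open Scope complex_scope.
Variable R : realType.
Local Notation C := R[i].

Lemma norm_real_complex (t : R) : `|t%:C| = `|t|%:C.
Proof. by rewrite normc_def /= expr0n addr0 sqrtr_sqr. Qed.

Lemma ge0_complexP (z : C) : 0 <= z -> exists2 r : R, 0 <= r & z = r%:C.
Proof.
move=> z0; have /complex_realP[r zE] := ger0_real z0.
by exists r => //; rewrite -ler0c -zE.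
Qed.

Lemma real_complex_continuous : continuous (fun t : R => t%:C : C).
Proof.
move=> t; have FF : Filter (nbhs t) := nbhs_filter t.
apply/(@cvgrPdist_lt _ _ _ (nbhs t) FF) => e e0.
have [r _ eE] := ge0_complexP (ltW e0); rewrite eE ltcR in e0 *.
have := nbhsx_ballx t r e0; apply: filterS => s ts.
by rewrite -rmorphB norm_real_complex ltcR.
Qed.

Lemma segment_continuous (u v : C) : continuous (fun t : R => u + t%:C * v).
Proof.
move=> t; have FF : Filter (nbhs t) := nbhs_filter t.
have cst (w : C) : (fun=> w) @ nbhs t --> w by exact: cvg_cst.
exact: (cvgD (cst u) (cvgM (@real_complex_continuous t) (cst v))).
Qed.

(** A primitive cube root of unity. *)
Definition omega3 : C := (sqrtC (- 3) - 1) / 2.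

Lemma omega3_quadratic : omega3 ^+ 2 + omega3 + 1 = 0.
Proof.
have s3 : sqrtC (- 3) ^+ 2 = - 3 :> C by rewrite sqrtCK.
have -> : omega3 ^+ 2 + omega3 + 1 = (sqrtC (- 3) ^+ 2 + 3) / 4.
  by rewrite /omega3; field.
by rewrite s3 addNr mul0r.
Qed.

Lemma omega3_cube : omega3 ^+ 3 = 1.
Proof.
apply/eqP; rewrite -subr_eq0; apply/eqP.
transitivity ((omega3 - 1) * (omega3 ^+ 2 + omega3 + 1)); first by ring.
by rewrite omega3_quadratic mulr0.
Qed.

Lemma omega3_neq1 : omega3 != 1.
Proof.
apply/eqP => w1; have := omega3_quadratic; rewrite w1 expr1n => /eqP.
by rewrite -addrA -[_ + _]/(3%:R) pnatr_eq0.
Qed.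

Lemma omega3_sqr_neq1 : omega3 ^+ 2 != 1.
Proof.
apply/eqP => w2; have := omega3_cube; rewrite exprS w2 mulr1 => /eqP.
by rewrite (negPf omega3_neq1).
Qed.

Lemma omega3_neq0 : omega3 != 0.
Proof.
apply/eqP => w0; have /eqP := omega3_quadratic.
by rewrite w0 expr0n !add0r oner_eq0.
Qed.

Lemma norm_cube_root1 (w : C) : w ^+ 3 = 1 -> `|w| = 1.
Proof.
move=> /(congr1 Num.norm); rewrite normrX normr1 => /eqP.
by rewrite pexpr_eq1 // => /eqP.
Qed.

Lemma omega3_expI (i j : 'I_3) : omega3 ^+ i = omega3 ^+ j -> i = j.
Proof.
have n1 := omega3_neq1; have n2 := omega3_sqr_neq1; have n0 := omega3_neq0.
have n12 : omega3 ^+ 2 != omega3.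
  by rewrite -subr_eq0 expr2 -{3}[omega3]mulr1 -mulrBr mulf_neq0 // subr_eq0.
case: i j => [[|[|[|//]]] i3] [[|[|[|//]]] j3] /eqP //=;
  rewrite ?expr0 ?expr1 ?(negPf n1) ?(negPf n2) ?(negPf n12) //;
  by rewrite 1?eq_sym ?(negPf n1) ?(negPf n2) ?(negPf n12) // => _; exact: val_inj.
Qed.

(** Three rays issuing from 0. Every dessin is locally the preimage of this set by
    a quotient of two polynomials. *)
Definition cube_rays : set C := [set w | 0 <= w ^+ 3].

Lemma cube_raysP (w : C) : cube_rays w <->
  exists (i : 'I_3) (r : R), 0 <= r /\ w = r%:C * omega3 ^+ i.
Proof.
split=> [|[i [r [r0 ->]]]]; last first.
  by rewrite /cube_rays /= exprMn -exprM mulnC exprM omega3_cube expr1n mulr1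
    exprn_ge0 // ler0c.
rewrite /cube_rays /= => w3.
have [y0 yw] : 0 <= 3.-root (w ^+ 3) /\ (3.-root (w ^+ 3)) ^+ 3 = w ^+ 3.
  by rewrite rootC_ge0 // rootCK.
have [r r0 yr] := ge0_complexP y0; move: yw; rewrite yr => yw {yr y0}.
have /eqP : (w - r%:C) * (w - r%:C * omega3) * (w - r%:C * omega3 ^+ 2) = 0.
  transitivity (w ^+ 3 - r%:C ^+ 3 * omega3 ^+ 3 - w * r%:C * (w - r%:C * omega3)
     * (omega3 ^+ 2 + omega3 + 1)); first by ring.
  by rewrite omega3_cube omega3_quadratic mulr1 mulr0 subr0 yw subrr.
rewrite !mulf_eq0 !subr_eq0 => /orP[/orP[]|] /eqP wE.
- by exists (Ordinal (isT : 0 < 3)%N), r; rewrite expr0 mulr1.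
- by exists (Ordinal (isT : 1 < 3)%N), r; rewrite expr1.
- by exists (Ordinal (isT : 2 < 3)%N), r.
Qed.

Lemma star_cube_rays0 : star_degree R cube_rays 0 3.
Proof.
have n0 i : omega3 ^+ i != 0 by rewrite expf_neq0 // omega3_neq0.
have n1 i : `|omega3 ^+ i| = 1.
  by apply: norm_cube_root1; rewrite -exprM mulnC exprM omega3_cube expr1n.
have z01 : `[0, 1]%classic (0 : R) by rewrite /= in_itv /= lexx ler01.
exists (fun (i : 'I_3) t => 0 + t%:C * omega3 ^+ i); split.
- by move=> i; apply: continuous_subspaceT; exact: segment_continuous.
- by move=> i t u _ _; rewrite !add0r => /(mulIf (n0 i)) /complexI.
- by move=> i; rewrite mul0r addr0.
- move=> i j ij; apply/seteqP; split=> z; last first.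
    by move=> ->; split; exists 0 => //; rewrite mul0r addr0.
  move=> [[t /= t01 <-] [u /= u01]]; rewrite !add0r => tu.
  have [t0 u0] : 0 <= t /\ 0 <= u.
    by move: t01 u01; rewrite !in_itv /= => /andP[-> _] /andP[-> _].
  have : u%:C = t%:C :> C.
    have /(congr1 Num.norm) := tu; rewrite !normrM !n1 !mulr1 !norm_real_complex.
    by rewrite !ger0_norm.
  move=> /complexI ut; move: tu; rewrite ut => /eqP; rewrite -subr_eq0 -mulrBr.
  rewrite mulf_eq0 => /orP[/eqP ->|]; first by rewrite mul0r.
  by rewrite subr_eq0 => /eqP /omega3_expI ji; rewrite ji eqxx in ij.
- have := nbhsx_ballx (0 : C) 1 ltr01; apply: filterS => z.
  rewrite /ball /= sub0r normrN => z1; split=> [/cube_raysP[i [r [r0 zE]]]|].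
    right; exists i; exists r; last by rewrite add0r zE.
    move: z1; rewrite zE normrM n1 mulr1 norm_real_complex ger0_norm //.
    by rewrite -[1]/(1%:C) ltcR /= in_itv /= r0 => /ltW.
  case=> [->|[i [t t01 <-]]]; first by rewrite /cube_rays /= expr0n.
  apply/cube_raysP; exists i, t; rewrite add0r; split=> //.
  by move: t01; rewrite /= in_itv /= => /andP[].
Qed.

(** Of the two factors of q^3 - |q|^3, the quadratic one takes the value 3 at
    q = 1, so it does not vanish near 1. *)
Lemma nonneg_cube_near1 :
  \forall q \near (1 : C), 0 <= q ^+ 3 -> q = `|q|.
Proof.
have FF : Filter (nbhs (1 : C)) := nbhs_filter (1 : C).
have cvid : id @ nbhs (1 : C) --> (1 : C) by exact: cvg_id.
have nc : (fun q : C => `|q|) @ nbhs (1 : C) --> `|1 : C|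
    by exact: norm_continuous.
have H : (fun q : C => q * q + q * `|q| + `|q| * `|q|) @ nbhs (1 : C) -->
    (1 * 1 + 1 * `|1| + `|1| * `|1| : C).
  exact: (cvgD (cvgD (cvgM cvid cvid) (cvgM cvid nc)) (cvgM nc nc)).
rewrite normr1 !mulr1 in H.
have n3 : (1 + 1 + 1 : C) != 0 by rewrite -addrA -[_ + _]/(3%:R) pnatr_eq0.
apply: filterS (cvgr_neq0 _ H n3) => q q3 /ger0_norm; rewrite normrX => qE; apply/eqP.
have : (q - `|q|) * (q * q + q * `|q| + `|q| * `|q|) = 0.
  by transitivity (q ^+ 3 - `|q| ^+ 3); [ring | rewrite qE subrr].
by move/eqP; rewrite mulf_eq0 (negPf q3) orbF subr_eq0.
Qed.

Lemma star_cube_rays1 (w : C) : w ^+ 3 = 1 -> star_degree R cube_rays w 2.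
Proof.
move=> w3; have w1 := norm_cube_root1 w3.
have w0 : w != 0 by rewrite -normr_gt0 w1.
pose s (i : 'I_2) : R := (-1) ^+ i / 2.
have s2 i : s i ^+ 2 = 1 / 4.
  by rewrite /s expr_div_n -exprM mulnC exprM sqrrN !expr1n; congr (_ / _); ring.
have s0 i : s i != 0 by rewrite -sqrf_eq0 s2 mul1r invr_eq0.
have z01 : `[0, 1]%classic (0 : R) by rewrite /= in_itv /= lexx ler01.
have gE (i : 'I_2) (t : R) : w + t%:C * (w * (s i)%:C) = w * (1 + s i * t)%:C.
  move: (s i) => x; rewrite rmorphD rmorphM rmorph1 mulrDr mulr1.
  congr (_ + _); rewrite [LHS]mulrCA; congr (_ * _); exact: mulrC.
have sN i j : i != j -> s i = - s j.
  rewrite /s; case: i j => [[|[|//]] i2] [[|[|//]] j2] //= _.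
  - by rewrite expr1 expr0 mulNr opprK.
  - by rewrite expr1 expr0 mulNr.
exists (fun (i : 'I_2) t => w + t%:C * (w * (s i)%:C)); split.
- by move=> i; apply: continuous_subspaceT; exact: segment_continuous.
- by move=> i t u _ _; rewrite !gE => /(mulfI w0) /complexI /addrI /(mulfI (s0 i)).
- by move=> i; rewrite mul0r addr0.
- move=> i j ij; apply/seteqP; split=> z; last first.
    by move=> ->; split; exists 0 => //; rewrite mul0r addr0.
  move=> [[t /= t01 <-] [u /= u01]]; rewrite !gE (sN i j ij).
  move=> /(mulfI w0) /complexI /addrI; rewrite mulNr -mulrN => /(mulfI (s0 j)) ut.
  have -> : t = 0 by move: t01 u01; rewrite !in_itv /= => /andP[? ?] /andP[? ?]; lra.
  by rewrite oppr0 mulr0 addr0 mulr1.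
- have FF : Filter (nbhs w) := nbhs_filter w.
  have cst (u : C) : (fun=> u) @ nbhs w --> u by exact: cvg_cst.
  have cvid : id @ nbhs w --> w by exact: cvg_id.
  have qc : (fun z => z * w^-1) @ nbhs w --> (w * w^-1 : C).
    exact: (cvgM cvid (cst w^-1)).
  rewrite mulfV // in qc.
  have h0 : 0 < (1 / 2)%:C :> C by rewrite -[0]/(0%:C) ltcR; lra.
  have n1 : \forall z \near w, 0 <= (z * w^-1) ^+ 3 -> z * w^-1 = `|z * w^-1|.
    exact: (qc _ nonneg_cube_near1).
  have n2 : \forall z \near w, `|1 - z * w^-1| < (1 / 2)%:C.
    by move/(@cvgrPdist_lt _ _ _ (nbhs w) FF) : qc; apply.
  apply: filterS2 n1 n2 => z zq zb; split=> [z3|].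
    have [|r r0 qr] := ge0_complexP (_ : 0 <= z * w^-1).
      by rewrite zq // exprMn exprVn w3 invr1 mulr1.
    have zE : z = w * r%:C by rewrite -qr mulrCA mulfV ?mulr1.
    move: zb; rewrite qr -[1]/(1%:C) -rmorphB norm_real_complex ltcR.
    rewrite ltr_norml => /andP[r1 r2]; right; have [r_ge1|r_lt1] := leP 1 r.
      exists (Ordinal (isT : 0 < 2)%N), (2 * (r - 1)).
        by rewrite /= in_itv /=; apply/andP; split; lra.
      by rewrite gE zE /s expr0; congr (_ * _%:C); field.
    exists (Ordinal (isT : 1 < 2)%N), (2 * (1 - r)).
      by rewrite /= in_itv /=; apply/andP; split; lra.
    by rewrite gE zE /s expr1; congr (_ * _%:C); field.
  case=> [->|[i [t t01 <-]]]; first by rewrite /cube_rays /= w3.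
  rewrite gE /cube_rays /= exprMn w3 mul1r exprn_ge0 // ler0c.
  have : -1 <= 2 * s i.
    by rewrite /s; case: i => [[|[|//]] i2] /=; rewrite ?expr0 ?expr1; lra.
  move: t01; rewrite /= in_itv /= => /andP[t0 t1] si.
  by have : - t <= 2 * s i * t; [rewrite -mulN1r ler_wpM2r | lra].
Qed.

End CubeRays.

(** * The j-invariant in terms of Lagrange resolvents *)

Section JInvariant.
Variable R : realType.
Local Open Scope complex_scope.
Local Notation C := R[i].
Local Notation w := (omega3 R).

(** The point of the sphere with homogeneous coordinates (a : b). *)
Definition proj_point (a b : C) : P1 R := if b == 0 then None else Some (a / b).

Lemma proj_pointZ (k a b : C) : k != 0 -> proj_point (k * a) (k * b) = proj_point a b.
Proof.
move=> k0; rewrite /proj_point mulf_eq0 (negPf k0) /=; case: eqP => // _.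
by rewrite -mulf_div divff // mul1r.
Qed.

Lemma proj_point_eq (a b c : C) : b != 0 -> proj_point a b = Some c <-> a = c * b.
Proof.
move=> b0; rewrite /proj_point (negPf b0); split=> [[<-]|->]; first by rewrite divfK.
by rewrite mulfK.
Qed.

(** The j-invariant of three roots with Lagrange resolvents u and - v. *)
Definition j_resolvent (u v : C) : P1 R :=
  proj_point (4 * (u * v) ^+ 3) ((u ^+ 3 + v ^+ 3) ^+ 2).

Lemma omega3_sqr : w ^+ 2 = - w - 1.
Proof.
apply/eqP; rewrite -subr_eq0; apply/eqP; rewrite -[RHS](omega3_quadratic R); ring.
Qed.

Lemma j_of_lambda_infty : j_of_lambda None = None :> P1 R.
Proof.
rewrite /j_of_lambda /ratmap; set p := 4 *: _; set q := 27 *: _.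
have sp : size p = 7%N.
  rewrite size_scale ?pnatr_eq0 //.
  have -> : 'X^2 - 'X + 1 = 'X^2 + (1 - 'X) :> {poly C} by ring.
  have s3 : size ('X^2 + (1 - 'X) : {poly C}) = 3%N.
    by rewrite size_polyDl size_polyXn // -size_polyN opprB size_XsubC.
  have := size_exp ('X^2 + (1 - 'X) : {poly C}) 3; rewrite s3 /=.
  by case: (size _) => // k /= ->.
have sq : (size q <= 5)%N.
  rewrite (leq_trans (size_scale_leq _ _)) // (leq_trans (size_polyMleq _ _)) //.
  rewrite size_polyXn /=; have := size_exp ('X - 1 : {poly C}) 2.
  by rewrite size_XsubC /=; case: (size _) => // k /= ->.
rewrite sp (maxn_idPl _) ?(leq_trans sq) //=.
by rewrite [q`_6]nth_default ?eqxx // (leq_trans sq).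
Qed.

(** If u and v are the two arguments of [j_resolvent], then
    u v = - (a^2 - a b + b^2) and (u^3 + v^3)^2 = - 27 a^2 b^2 (a - b)^2. *)
Lemma j_of_proj_point (a b : C) :
  j_of_lambda (proj_point a b) = j_resolvent (a + w * b) (- (a + w ^+ 2 * b)).
Proof.
rewrite /j_resolvent.
have -> : 4 * ((a + w * b) * - (a + w ^+ 2 * b)) ^+ 3 =
    - (4 * (a ^+ 2 - a * b + b ^+ 2) ^+ 3).
  by rewrite omega3_sqr; ring: omega3_sqr.
have -> : ((a + w * b) ^+ 3 + (- (a + w ^+ 2 * b)) ^+ 3) ^+ 2 =
    - (27 * (a ^+ 2 * b ^+ 2 * (a - b) ^+ 2)).
  by rewrite omega3_sqr; ring: omega3_sqr.
rewrite -[- (4 * _)]mulN1r -[- (27 * _)]mulN1r proj_pointZ ?oppr_eq0 ?oner_eq0 //.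
rewrite {1}/proj_point; have [->|b0] := eqVneq b 0.
  by rewrite j_of_lambda_infty /proj_point expr0n /= mulr0 mul0r mulr0 eqxx.
have -> (x : C) : j_of_lambda (Some x) =
    proj_point (4 * (x ^+ 2 - x + 1) ^+ 3) (27 * (x ^+ 2 * (x - 1) ^+ 2)).
  transitivity (proj_point (4 *: ('X^2 - 'X + 1) ^+ 3).[x]
    (27 *: ('X^2 * ('X - 1) ^+ 2)).[x]); first by [].
  by rewrite !(hornerZ, horner_exp, hornerM, hornerD, hornerN, hornerXn, hornerX,
    hornerC).
have E1 : 4 * (a ^+ 2 - a * b + b ^+ 2) ^+ 3 =
    b ^+ 6 * (4 * ((a / b) ^+ 2 - a / b + 1) ^+ 3) by field.
have E2 : 27 * (a ^+ 2 * b ^+ 2 * (a - b) ^+ 2) =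
    b ^+ 6 * (27 * ((a / b) ^+ 2 * (a / b - 1) ^+ 2)) by field.
by rewrite E1 E2 proj_pointZ // expf_neq0.
Qed.

(** With m = (u / v)^3, the equation j = s reads s (1 + m)^2 = 4 m. For s in
    (0, 1] its two roots are positive reals, inverse to each other. When v = 0
    the right-hand side holds because division by 0 gives 0, in accordance with
    j = 0. *)
Lemma graph_resolventP (u v : C) : u != 0 \/ v != 0 ->
  real_pts `[0, 1] (j_resolvent u v) <-> 0 <= (u / v) ^+ 3.
Proof.
move=> uv0; have [v0|v0] := eqVneq v 0.
  have u0 : u != 0 by case: uv0 => //; rewrite v0 eqxx.
  rewrite v0 invr0 mulr0 expr0n /=; split=> // _.
  exists 0; first by rewrite /= in_itv /= lexx ler01.
  rewrite /j_resolvent mulr0 expr0n /= mulr0 addr0 /proj_point.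
  by rewrite expf_eq0 /= expf_eq0 /= (negPf u0) mul0r.
set m := (u / v) ^+ 3.
have -> : j_resolvent u v = proj_point (4 * m) ((1 + m) ^+ 2).
  rewrite -(@proj_pointZ (v ^+ 6)) ?expf_neq0 // /j_resolvent /m.
  by congr proj_point; field.
split=> [[s]|m0].
  rewrite /= in_itv /= => /andP[s0 s1] sE.
  have m1 : 1 + m != 0.
    by apply/eqP => m1; move: sE; rewrite m1 /proj_point expr0n eqxx.
  have {}sE : 4 * m = s%:C * (1 + m) ^+ 2.
    by apply/proj_point_eq; [rewrite expf_neq0|rewrite sE].
  have [s_0|sN0] := eqVneq s 0.
    move: sE; rewrite s_0 mul0r => /eqP; rewrite mulf_eq0 pnatr_eq0 /=.
    by move=> /eqP ->.
  have {s0}s0 : 0 < s by rewrite lt_neqAle eq_sym sN0.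
  (* m is a root of a reciprocal quadratic with real positive roots *)
  pose k := 2 / s - 1; have k1 : 1 <= k.
    by rewrite /k lerBrDr -(@natrD _ 1 1) ler_pdivlMr // ler_piMr.
  pose d := Num.sqrt (k ^+ 2 - 1).
  have d2 : d ^+ 2 = k ^+ 2 - 1 by rewrite sqr_sqrtr // subr_ge0 exprn_ege1.
  have d0 : 0 <= d by exact: sqrtr_ge0.
  have dk : d <= k.
    by rewrite -(@ler_pXn2r _ 2) ?nnegrE ?(le_trans _ k1) // d2 gerBl.
  have : (m - k%:C - d%:C) * (m - k%:C + d%:C) = 0.
    have kE : k%:C = 2 / s%:C - 1.
      by rewrite /k rmorphB rmorph1 fmorph_div rmorph_nat.
    have d2E : d%:C ^+ 2 = k%:C ^+ 2 - 1 by rewrite -rmorphXn d2 rmorphB rmorphXn rmorph1.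
    transitivity (m ^+ 2 - 2 * m * k%:C + k%:C ^+ 2 - d%:C ^+ 2); first by ring.
    rewrite d2E kE.
    have sC : s%:C != 0 :> C by rewrite -[0]/(0%:C) (inj_eq (@complexI _)).
    transitivity ((s%:C * (1 + m) ^+ 2 - 4 * m) / s%:C); first by field.
    by rewrite sE subrr mul0r.
  move/eqP; rewrite mulf_eq0 => /orP[] /eqP mE.
    have -> : m = (k + d)%:C.
      by rewrite rmorphD; apply/eqP; rewrite -subr_eq0 opprD addrA mE.
    by rewrite ler0c addr_ge0 // (le_trans _ k1).
  have -> : m = (k - d)%:C.
    by rewrite rmorphB; apply/eqP; rewrite -subr_eq0 opprB addrA addrAC mE.
  by rewrite ler0c subr_ge0.
have [r r0 mr] := ge0_complexP m0.
have r1 : 1 + r != 0 by rewrite gt_eqF // ltr_wpDr.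
exists (4 * r / (1 + r) ^+ 2).
  rewrite /= in_itv /= divr_ge0 ?mulr_ge0 ?exprn_ge0 ?addr_ge0 //=.
  rewrite ler_pdivrMr ?exprn_gt0 ?mul1r ?ltr_wpDr //.
  by rewrite -subr_ge0 (_ : _ - _ = (1 - r) ^+ 2) ?sqr_ge0 //; ring.
rewrite mr; symmetry; apply/proj_point_eq.
  by rewrite expf_neq0 // -[1]/(1%:C) -rmorphD -[0]/(0%:C) (inj_eq (@complexI _)).
have -> : 1 + r%:C = (1 + r)%:C :> C by rewrite rmorphD rmorph1.
rewrite -rmorphXn -rmorphM divfK ?expf_neq0 //.
by rewrite rmorphM rmorph_nat.
Qed.

Lemma bullet_resolventP (u v : C) : j_resolvent u v = Some 0 -> u = 0 \/ v = 0.
Proof.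
rewrite /j_resolvent /proj_point; case: ifPn => // d0 [] /eqP.
rewrite mulf_eq0 invr_eq0 (negPf d0) orbF.
rewrite mulf_eq0 pnatr_eq0 expf_eq0 /= mulf_eq0 => /orP[] /eqP ->; by [left|right].
Qed.

Lemma circle_resolventP (u v : C) :
  j_resolvent u v = Some 1 -> v != 0 /\ (u / v) ^+ 3 = 1.
Proof.
rewrite /j_resolvent /proj_point; case: ifPn => // d0 [].
move=> /(congr1 ( *%R^~ ((u ^+ 3 + v ^+ 3) ^+ 2))); rewrite divfK // mul1r => E.
have : (u ^+ 3 - v ^+ 3) ^+ 2 = 0.
  transitivity ((u ^+ 3 + v ^+ 3) ^+ 2 - 4 * (u * v) ^+ 3); first by ring.
  by rewrite E subrr.
move=> /eqP; rewrite expf_eq0 /= subr_eq0 => /eqP u3.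
have v0 : v != 0.
  by apply/eqP => v0; move: d0; rewrite u3 v0 expr0n addr0 expr0n eqxx.
by split=> //; rewrite expr_div_n u3 divff // expf_neq0.
Qed.

End JInvariant.

(** * Charts of the Riemann sphere *)

Section RiemannSphere.
Variable R : realType.
Local Open Scope complex_scope.
Local Notation C := R[i].

(** A square of the complex plane. As a continuous image of a square of R x R it
    is compact, which is why it replaces a disk here. *)
Definition box (M : R) : set C :=
  (fun ab : R * R => ab.1%:C + ab.2%:C * 'i) @` (`[- M, M] `*` `[- M, M]).

Lemma box_compact (M : R) : compact (box M).
Proof.
apply: continuous_compact; last by apply: compact_setX; exact: segment_compact.
apply: continuous_subspaceT => ab.
have FF : Filter (nbhs ab) := nbhs_filter ab.
have c1 : (fun ab : R * R => ab.1%:C : C) @ nbhs ab --> (ab.1%:C : C).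
  have f1 : fst @ nbhs ab --> ab.1 by exact: cvg_fst.
  exact: (cvg_comp _ _ f1 (@real_complex_continuous R ab.1)).
have c2 : (fun ab : R * R => ab.2%:C : C) @ nbhs ab --> (ab.2%:C : C).
  have f2 : snd @ nbhs ab --> ab.2 by exact: cvg_snd.
  exact: (cvg_comp _ _ f2 (@real_complex_continuous R ab.2)).
have ci : (fun=> 'i : C) @ nbhs ab --> ('i : C) by exact: cvg_cst.
exact: (cvgD c1 (cvgM c2 ci)).
Qed.

Lemma complex_hausdorff : hausdorff_space C.
Proof. exact: norm_hausdorff. Qed.

Lemma box_closed (M : R) : closed (box M).
Proof. by apply: compact_closed; [exact: complex_hausdorff | exact: box_compact]. Qed.

Lemma norm_le_box (M : R) (z : C) : `|z| <= M%:C -> box M z.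
Proof.
move=> zM; exists (complex.Re z, complex.Im z) => /=; last first.
  by rewrite mulrC -complexE.
move: zM; rewrite normc_def lecR => zM.
have sub (a b : R) : Num.sqrt (a ^+ 2 + b ^+ 2) <= M -> a \in `[- M, M]%R.
  move=> abM; rewrite in_itv /= -ler_norml (le_trans _ abM) // -sqrtr_sqr.
  by rewrite ler_wsqrtr // lerDl sqr_ge0.
by split; apply: sub; [exact: zM | rewrite addrC; exact: zM].
Qed.

Lemma complex_locally_compact : locally_compact [set: C].
Proof.
move=> z _; rewrite withinET; have [r r0 zr] := ge0_complexP (normr_ge0 z).
exists (box (r + 1)); last by split; [exact: box_compact | exact: box_closed].
have := nbhsx_ballx z (1 : C) ltr01; apply: filterS => y; rewrite /ball /= => zy.
have rE : (r + 1)%:C = `|z| + 1 :> C by rewrite zr rmorphD rmorph1.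
apply: norm_le_box; rewrite rE -[y in `|y|](subrKC z).
by rewrite (le_trans (ler_normD _ _)) // lerD2l distrC ltW.
Qed.

Lemma sphere_hausdorff : hausdorff_space (P1 R).
Proof.
apply: one_point_compactification_hausdorff; last exact: complex_hausdorff.
exact: complex_locally_compact.
Qed.

(** The inverse of [chart z] on [chart_range z]; the value 0 elsewhere is
    arbitrary. *)
Definition unchart (z y : P1 R) : C :=
  match z, y with
  | Some x0, Some x => x - x0
  | None, Some x => x^-1
  | _, None => 0
  end.

Definition chart_range (z : P1 R) : set (P1 R) :=
  if z is Some _ then [set~ None] else [set~ Some 0].

Lemma chart0 (z : P1 R) : chart z 0 = z.
Proof. by case: z => [x|] /=; rewrite ?addr0 ?eqxx. Qed.

Lemma chartK (z : P1 R) : cancel (chart z) (unchart z).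
Proof.
case: z => [x|] t /=; first by rewrite addrC addKr.
by case: eqP => [->|_] //=; rewrite invrK.
Qed.

Lemma unchartK (z y : P1 R) : chart_range z y -> chart z (unchart z y) = y.
Proof.
case: z y => [x|] [y|] //= yr; first by rewrite addrC subrK.
- by rewrite invr_eq0 invrK; case: eqP yr => [->|].
- by rewrite eqxx.
Qed.

Lemma sphere_nbhs_infty_of_chart (N : set C) : nbhs (0 : C) N ->
  nbhs (None : P1 R) (chart None @` N).
Proof.
move=> /nbhs_ballP[e /= e0 eN]; have [r _ eE] := ge0_complexP (ltW e0).
have r0 : 0 < r by rewrite -ltcR -eE.
exists (box r^-1); first by split; [exact: box_compact | exact: box_closed].
move=> _ [[x nx <-]|->]; last first.
  by exists 0; [apply: eN; exact: ballxx | rewrite chart0].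
have x1 : r^-1%:C < `|x|.
  rewrite real_ltNge ?normr_real //; last by apply/complex_realP; exists r^-1.
  by apply/negP => /norm_le_box.
have xn0 : x != 0.
  by rewrite -normr_gt0 (lt_trans _ x1) // -[0]/(0%:C) ltcR invr_gt0.
exists x^-1; last by rewrite /= invr_eq0 (negPf xn0) invrK.
apply: eN; rewrite /ball /= sub0r normrN normfV eE.
rewrite -[r%:C]invrK ltf_pV2 ?posrE ?normr_gt0 // -?fmorphV //.
by rewrite -[0]/(0%:C) ltcR invr_gt0.
Qed.

Lemma chart_open (z : P1 R) (N : set C) :
  nbhs (0 : C) N -> nbhs z (chart z @` N).
Proof.
case: z => [x|] nN; last exact: sphere_nbhs_infty_of_chart.
have /nbhs_ballP[e /= e0 eN] := nN.
have nb : nbhs x (ball x e) by exact: nbhsx_ballx.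
have := @one_point_compactification_some_nbhs C x _ nb.
apply: filterS => _ [y xy <-]; exists (y - x); last by rewrite /= addrC subrK.
by apply: eN; move: xy; rewrite /ball /= sub0r normrN distrC.
Qed.

Lemma some_inv_continuous (t : C) : t != 0 ->
  {for t, continuous (fun t : C => Some t^-1 : P1 R)}.
Proof.
by move=> t0 A nA; exact: (@inv_continuous _ t t0 (Some @^-1` A) nA).
Qed.

Lemma product_neq1_near0 (x : C) :
  \forall z \near (x, (0 : C)), z.1 * z.2 != 1.
Proof.
pose z0 : C * C := (x, 0); have FF : Filter (nbhs z0) := nbhs_filter z0.
have f1 : (fun z : C * C => z.1) @ nbhs z0 --> z0.1 by exact: cvg_fst.
have f2 : (fun z : C * C => z.2) @ nbhs z0 --> z0.2 by exact: cvg_snd.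
have c1 : (fun=> 1 : C) @ nbhs z0 --> (1 : C) by exact: cvg_cst.
have c0 : z0.1 * z0.2 - 1 != 0 by rewrite mulr0 sub0r oppr_eq0 oner_eq0.
have cd : (fun z : C * C => z.1 * z.2 - 1) @ nbhs z0 --> z0.1 * z0.2 - 1.
  exact: (cvgB (cvgM f1 f2) c1).
by apply: filterS (cvgr_neq0 _ cd c0) => z; rewrite subr_eq0.
Qed.

Lemma chart_continuous (z : P1 R) : continuous (chart z).
Proof.
case: z => [x|] t.
  have FF : Filter (nbhs t) := nbhs_filter t.
  have cst : (fun=> x) @ nbhs t --> x by exact: cvg_cst.
  have idt : id @ nbhs t --> t by exact: cvg_id.
  have xt : (fun u => x + u) @ nbhs t --> x + t by exact: (cvgD cst idt).
  by move=> A nA; exact: (xt (Some @^-1` A) nA).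
have [->|t0] := eqVneq t 0; last first.
  have n0 : \forall u \near t, u != 0.
    have idt : id @ nbhs t --> t by exact: cvg_id.
    exact: (cvgr_neq0 _ idt t0).
  rewrite /continuous_at /= (negPf t0) => A nA.
  have nA' : \forall u \near t, A (Some u^-1) by exact: (some_inv_continuous t0 nA).
  apply: filterS2 n0 nA' => u u0 Au.
  by rewrite /= (negPf u0).
rewrite /continuous_at chart0 => A [K [cK _] KA].
move/compact_near_coveringP : cK => cK.
(* for t close to 0 the point 1 / t is outside the compact set K, because x t is
   uniformly close to 0 for x in K *)
have nK : \forall t \near (0 : C), K `<=` (fun x => x * t != 1).
  apply: (cK C (nbhs (0 : C)) (fun t x => x * t != 1)) => x Kx.
  exact: (product_neq1_near0 x).
apply: filterS nK => u Ku; apply: KA; rewrite /=; case: eqP => [_|/eqP u0].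
  by right.
by left; exists u^-1 => // /Ku; rewrite mulVf ?eqxx.
Qed.

Lemma chart_range_open (z : P1 R) : open (chart_range z).
Proof.
have := hausdorff_accessible sphere_hausdorff.
move=> /accessible_closed_set1 c1.
by case: z => [x|]; apply: closed_openC; exact: c1.
Qed.

Lemma unchart_continuous (z y : P1 R) : chart_range z y ->
  {for y, continuous (unchart z)}.
Proof.
case: z y => [x0|] [x|] yr A nA.
- have FF : Filter (nbhs x) := nbhs_filter x.
  have cst : (fun=> x0) @ nbhs x --> x0 by exact: cvg_cst.
  have idx : id @ nbhs x --> x by exact: cvg_id.
  have xx : (fun u => u - x0) @ nbhs x --> x - x0 by exact: (cvgB idx cst).
  exact: (xx A nA).
- by case: yr.
- have xn0 : x != 0 by apply/eqP => x_0; apply: yr; rewrite x_0.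
  exact: (@inv_continuous _ x xn0 A nA).
- have : nbhs (None : P1 R) (chart None @` A) by exact: chart_open.
  apply: filterS => _ [t At <-].
  by suff : A (unchart None (chart None t)) by []; rewrite chartK.
Qed.

End RiemannSphere.

(** * The dessin in local coordinates *)

Section LocalPolynomials.
Variables (R : realType) (n : nat).
Local Open Scope complex_scope.
Local Notation C := R[i].
Implicit Types (p q : {poly C}) (z : P1 R).

(** The polynomial p, seen as homogeneous of degree n, in the chart at z: it is
    p (x0 + t) at a finite point and t^n p (1 / t) at infinity. *)
Definition local_poly z p : {poly C} :=
  if z is Some x0 then p \Po ('X + x0%:P) else \poly_(i < n.+1) p`_(n - i).

Definition homog_value p z : C := if z is Some x then p.[x] else p`_n.

Lemma local_polyD z p q : local_poly z (p + q) = local_poly z p + local_poly z q.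
Proof.
case: z => [x|] /=; first exact: comp_polyD.
by apply/polyP => i; rewrite coefD !coef_poly coefD; case: ifP; rewrite ?addr0.
Qed.

Lemma local_polyZ z (c : C) p : local_poly z (c *: p) = c *: local_poly z p.
Proof.
case: z => [x|] /=; first exact: comp_polyZ.
by apply/polyP => i; rewrite coefZ !coef_poly coefZ; case: ifP; rewrite ?mulr0.
Qed.

Lemma local_infty_sum p : local_poly None p = \sum_(i < n.+1) p`_i *: 'X^(n - i).
Proof.
rewrite /local_poly poly_def (reindex_inj rev_ord_inj) /=.
apply: eq_bigr => i _; by rewrite subSS subKn // -ltnS ltn_ord.
Qed.

Lemma poly_sum_wide p : (size p <= n.+1)%N -> p = \sum_(i < n.+1) p`_i *: 'X^i.
Proof.
move=> sp; rewrite -poly_def; apply/polyP => i; rewrite coef_poly.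
by case: ltnP => // ni; rewrite nth_default // (leq_trans sp).
Qed.

Lemma local_infty_horner p (t : C) : t != 0 -> (size p <= n.+1)%N ->
  (local_poly None p).[t] = t ^+ n * p.[t^-1].
Proof.
move=> t0 sp; rewrite local_infty_sum {2}(poly_sum_wide sp) !horner_sum mulr_sumr.
apply: eq_bigr => i _; rewrite !hornerZ !hornerXn mulrCA; congr (_ * _).
have ni : (i <= n)%N by rewrite -ltnS.
have -> : t ^+ n = t ^+ (n - i) * t ^+ i by rewrite -exprD subnK.
by rewrite exprVn mulfK // expf_neq0.
Qed.

(** The factor k does not depend on p, so that it disappears from quotients. *)
Lemma local_poly_value z (t : C) : exists2 k : C, k != 0 &
  forall p, (size p <= n.+1)%N ->
    (local_poly z p).[t] = k * homog_value p (chart z t).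
Proof.
case: z => [x|].
  exists 1 => [|p _]; first exact: oner_neq0.
  by rewrite /= horner_comp mul1r hornerD hornerX hornerC addrC.
have [->|t0] := eqVneq t 0.
  exists 1 => [|p sp]; first exact: oner_neq0.
  by rewrite chart0 mul1r /= horner_coef0 coef_poly /= subn0.
exists (t ^+ n) => [|p sp]; first by rewrite expf_neq0.
by rewrite local_infty_horner //= (negPf t0).
Qed.

Lemma local_poly_inj0 z p : (size p <= n.+1)%N -> local_poly z p = 0 -> p = 0.
Proof.
case: z => [x|] sp /= p0.
  have s2 : (1 < size ('X + x%:P)%R)%N by rewrite size_XaddC.
  by apply/eqP; rewrite -(comp_poly_eq0 p s2) p0.
apply/polyP => i; rewrite coef0; case: (ltnP i n.+1) => ni; last first.
  by rewrite nth_default // (leq_trans sp).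
have := congr1 (fun q : {poly C} => q`_(n - i)) p0.
by rewrite coef_poly coef0 ltnS leq_subr subKn.
Qed.

(** The Euler identity for the homogenization of p. *)
Lemma local_infty_deriv p (t : C) : t != 0 -> (size p <= n.+1)%N ->
  t * (local_poly None p)^`().[t] =
  n%:R * (local_poly None p).[t] - t ^+ n * (t^-1 * p^`().[t^-1]).
Proof.
move=> t0 sp; rewrite local_infty_sum {3}(poly_sum_wide sp).
rewrite !raddf_sum /= !horner_sum !mulr_sumr -sumrB; apply: eq_bigr => i _.
rewrite !derivZ !derivXn !hornerZ !hornerMn !hornerXn.
have ni : (i <= n)%N by rewrite -ltnS.
set c := p`_i.
have E k : t * (c * (t ^+ k.-1 *+ k)) = c * (k%:R * t ^+ k).
  by case: k => [|k]; rewrite ?mulr0n ?mulr0 ?mul0r ?mulr0 // -mulr_natl exprS /=; ring.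
have E' k : t^-1 * (c * (t^-1 ^+ k.-1 *+ k)) = c * (k%:R * t^-1 ^+ k).
  by case: k => [|k]; rewrite ?mulr0n ?mulr0 ?mul0r ?mulr0 // -mulr_natl exprS /=; ring.
have -> : t ^+ n = t ^+ (n - i) * t ^+ i by rewrite -exprD subnK.
rewrite E E' exprVn natrB //.
by field; rewrite expf_neq0.
Qed.

Lemma wronskian_local_infty p q (t : C) : t != 0 ->
  (size p <= n.+1)%N -> (size q <= n.+1)%N ->
  t * (wronskian (local_poly None p) (local_poly None q)).[t] =
  - (t ^+ n * t ^+ n * t^-1 * (wronskian p q).[t^-1]).
Proof.
move=> t0 sp sq; rewrite /wronskian !(hornerD, hornerN, hornerM) mulrBr.
rewrite mulrA local_infty_deriv // [t * (_ * _)]mulrCA local_infty_deriv //.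
rewrite !local_infty_horner //; ring.
Qed.

Lemma wronskian_local_finite p q (x : C) :
  (wronskian (local_poly (Some x) p) (local_poly (Some x) q)).[0] = (wronskian p q).[x].
Proof.
rewrite /wronskian /= !deriv_comp derivD derivX derivC addr0 !mulr1.
have e0 : ('X + x%:P).[0] = x by rewrite hornerD hornerX hornerC add0r.
by rewrite -!comp_polyM -comp_polyB horner_comp e0.
Qed.

End LocalPolynomials.

Section CurveDessin.
Variables (R : realType) (n : nat).
Local Open Scope complex_scope.
Local Notation C := R[i].
Local Notation w := (omega3 R).
Implicit Types (c : crtc R n) (z : P1 R).

(** The Lagrange resolvents of y1, y2, y3, the second one with a minus sign: the
    sign turns the condition on the quotient u / v of the resolvents on the dessin
    into 0 <= (u / v)^3. *)
Definition resolvent1 c : {poly C} := y1 c + w *: y2 c + w ^+ 2 *: y3 c.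
Definition resolvent2 c : {poly C} := - (y1 c + w ^+ 2 *: y2 c + w *: y3 c).

Lemma size_crtc c :
  [/\ (size (y1 c) <= n.+1)%N, (size (y2 c) <= n.+1)%N & (size (y3 c) <= n.+1)%N].
Proof.
have := crtc_maxdeg c; move: (size _) (size _) (size _) => a b d <-.
by split; rewrite ?leq_max ?leqnn ?orbT.
Qed.

Lemma size_polyD_le (p q : {poly C}) (m : nat) :
  (size p <= m)%N -> (size q <= m)%N -> (size (p + q)%R <= m)%N.
Proof.
by move=> sp sq; rewrite (leq_trans (size_polyD _ _)) // geq_max sp.
Qed.

Lemma size_polyZ_le (a : C) (p : {poly C}) (m : nat) :
  (size p <= m)%N -> (size (a *: p)%R <= m)%N.
Proof. by move=> sp; rewrite (leq_trans (size_scale_leq _ _)). Qed.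

Lemma size_resolvents c :
  (size (resolvent1 c) <= n.+1)%N /\ (size (resolvent2 c) <= n.+1)%N.
Proof.
have [s1 s2 s3] := size_crtc c; rewrite /resolvent2 size_polyN.
by split; repeat (apply: size_polyD_le || apply: size_polyZ_le || assumption).
Qed.

Lemma homog_valueD (p q : {poly C}) z :
  homog_value n (p + q) z = homog_value n p z + homog_value n q z.
Proof. by case: z => [x|] /=; rewrite ?hornerD ?coefD. Qed.

Lemma homog_valueZ (a : C) (p : {poly C}) z :
  homog_value n (a *: p) z = a * homog_value n p z.
Proof. by case: z => [x|] /=; rewrite ?hornerZ ?coefZ. Qed.

Lemma homog_valueN (p : {poly C}) z : homog_value n (- p) z = - homog_value n p z.
Proof. by case: z => [x|] /=; rewrite ?hornerN ?coefN. Qed.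

Lemma homog_resolvents c z :
  let a := homog_value n (y1 c - y3 c) z in
  let b := homog_value n (y2 c - y3 c) z in
  homog_value n (resolvent1 c) z = a + w * b /\
  homog_value n (resolvent2 c) z = - (a + w ^+ 2 * b).
Proof.
rewrite /resolvent1 /resolvent2 !(homog_valueN, homog_valueD, homog_valueZ).
by rewrite omega3_sqr; split; ring.
Qed.

Lemma homog_difference_neq0 c z :
  ~ (homog_value n (y1 c - y3 c) z = 0 /\ homog_value n (y2 c - y3 c) z = 0).
Proof.
rewrite !(homog_valueN, homog_valueD) => -[/eqP + /eqP].
rewrite !subr_eq0 => /eqP E1 /eqP E2.
case: z E1 E2 => [x|] /= E1 E2.
  by apply: (crtc_no_triple (c := c) (x := x)); rewrite E1 E2.
by apply: (crtc_no_triple_infty (c := c)); rewrite E1 E2.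
Qed.

Lemma resolvents_neq0 c z :
  homog_value n (resolvent1 c) z != 0 \/ homog_value n (resolvent2 c) z != 0.
Proof.
apply/orP; rewrite -negb_and; apply/negP => /andP[/eqP u0 /eqP v0].
have [uE vE] := homog_resolvents c z.
apply: (@homog_difference_neq0 c z); rewrite uE in u0; rewrite vE in v0.
set a := homog_value _ _ _ in u0 v0 *; set b := homog_value _ (y2 c - _) _ in u0 v0 *.
have b0 : b = 0.
  have : (w ^+ 2 - w) * b = 0.
    transitivity (- (a + w * b) - (- (a + w ^+ 2 * b))); first by ring.
    by rewrite u0 v0 !oppr0 addr0.
  move/eqP; rewrite mulf_eq0 => /orP[|/eqP //].
  by rewrite expr2 -{3}[w]mulr1 -mulrBr mulf_eq0 (negPf (omega3_neq0 R)) subr_eq0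
    (negPf (omega3_neq1 R)).
by split=> //; move: u0; rewrite b0 mulr0 addr0.
Qed.

Lemma lambda_homog c z : lambda c z =
  proj_point (homog_value n (y1 c - y3 c) z) (homog_value n (y2 c - y3 c) z).
Proof.
rewrite /lambda /ratmap; case: z => [x|] //=.
have [s1 s2 s3] := size_crtc c.
suff -> : (maxn (size (y1 c - y3 c)%R) (size (y2 c - y3 c)%R)).-1 = n by [].
have sp : (size (y1 c - y3 c)%R <= n.+1)%N by rewrite size_polyD_le ?size_polyN.
have sq : (size (y2 c - y3 c)%R <= n.+1)%N by rewrite size_polyD_le ?size_polyN.
suff -> : maxn (size (y1 c - y3 c)%R) (size (y2 c - y3 c)%R) = n.+1 by [].
apply/eqP; rewrite eqn_leq geq_max sp sq /= leqNgt gtn_max !ltnS.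
apply/negP => /andP[lp lq]; apply: (@homog_difference_neq0 c None).
by rewrite /homog_value !nth_default.
Qed.

Lemma j_inv_homog c z : j_inv c z =
  j_resolvent (homog_value n (resolvent1 c) z) (homog_value n (resolvent2 c) z).
Proof.
rewrite /j_inv /= lambda_homog j_of_proj_point.
by have [-> ->] := homog_resolvents c z.
Qed.

Lemma j_resolventZ (k u v : C) : k != 0 -> j_resolvent (k * u) (k * v) = j_resolvent u v.
Proof.
move=> k0; rewrite /j_resolvent -[RHS](@proj_pointZ R (k ^+ 6)) ?expf_neq0 //.
by congr proj_point; ring.
Qed.

Definition local1 c z := local_poly n z (resolvent1 c).
Definition local2 c z := local_poly n z (resolvent2 c).

Lemma local_neq0 c z (t : C) : (local1 c z).[t] != 0 \/ (local2 c z).[t] != 0.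
Proof.
have [k k0 kP] := local_poly_value n z t; have [s1 s2] := size_resolvents c.
rewrite /local1 /local2 !kP // !mulf_eq0 (negPf k0) /=; exact: resolvents_neq0.
Qed.

Lemma j_inv_chart c z (t : C) :
  j_inv c (chart z t) = j_resolvent (local1 c z).[t] (local2 c z).[t].
Proof.
have [k k0 kP] := local_poly_value n z t; have [s1 s2] := size_resolvents c.
by rewrite /local1 /local2 !kP // j_resolventZ // j_inv_homog.
Qed.

Lemma graph_chart c z : chart z @^-1` graph (dessin_of c) =
  [set t | cube_rays ((local1 c z).[t] / (local2 c z).[t])].
Proof.
apply/seteqP; split=> t /=; rewrite j_inv_chart.
  by move/graph_resolventP; apply; exact: local_neq0.
by move/graph_resolventP; apply; exact: local_neq0.
Qed.

Lemma cube_raysV (a b : C) : cube_rays (a / b) <-> cube_rays (b / a).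
Proof. by rewrite /cube_rays /= -[b / a]invrK invf_div exprVn invr_ge0. Qed.

(** The maps u and v have no common zero but each of them, being homogeneous of
    degree n > 0, has a zero on the sphere; so they are not proportional. *)
Lemma local_independent c z (a : C) : (0 < n)%N ->
  local1 c z - a *: local2 c z != 0 /\ local2 c z - a *: local1 c z != 0.
Proof.
move=> n0; have [s1 s2] := size_resolvents c.
have zero (p : {poly C}) : (size p <= n.+1)%N -> exists y : P1 R, homog_value n p y = 0.
  move=> sp; case: (ltnP (size p) n.+1) => [pn|np].
    by exists None; rewrite /= nth_default.
  have /closed_rootP[x /rootP px] : size p != 1%N.
    by rewrite neq_ltn (leq_trans _ np) ?orbT.
  by exists (Some x).
have dep (p q : {poly C}) : (size p <= n.+1)%N -> (size q <= n.+1)%N ->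
    local_poly n z p - a *: local_poly n z q = 0 ->
    exists y, homog_value n p y = 0 /\ homog_value n q y = 0.
  move=> sp sq pq; have [y qy] := zero q sq; exists y; split=> //.
  have : p - a *: q = 0.
    apply: (@local_poly_inj0 R n z).
      by rewrite -scaleNr size_polyD_le // size_polyZ_le.
    by rewrite -scaleNr local_polyD local_polyZ scaleNr.
  move=> /eqP; rewrite subr_eq0 => /eqP ->.
  by rewrite homog_valueZ qy mulr0.
split; apply/eqP => /dep H.
  by have [//|//|y [u0 v0]] := H _ _; case: (resolvents_neq0 c y); rewrite ?u0 ?v0 eqxx.
by have [//|//|y [u0 v0]] := H _ _; case: (resolvents_neq0 c y); rewrite ?u0 ?v0 eqxx.
Qed.

End CurveDessin.

(** * Simple dessins are those of nondegenerate curves *)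

Section SimpleDessins.
Variables (R : realType) (n : nat).
Local Open Scope complex_scope.
Local Notation C := R[i].
Implicit Types (c : crtc R n) (z : P1 R).

Lemma star_degree_chart (G : set (P1 R)) z (k : nat) :
  star_degree R G z k <-> star_degree R (chart z @^-1` G) (0 : C) k.
Proof.
have un0 : unchart z z = 0 by rewrite -[X in unchart _ X](chart0 z) chartK.
have zr : chart_range z z by case: z {un0}.
split=> st.
  rewrite -un0; apply: (star_degree_transfer (U := chart_range z)) st => //.
  - exact: sphere_hausdorff.
  - exact: chart_range_open.
  - by move=> x; exact: unchart_continuous.
  - move=> x y; rewrite !inE => /unchartK xK /unchartK yK xy.
    by rewrite -xK xy yK.
  - move=> N nN; rewrite un0.
    have nN' : nbhs (chart z 0) N by rewrite chart0.
    have nt : \forall t \near (0 : C), N (chart z t).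
      exact: (@chart_continuous R z 0 N nN').
    by apply: filterS nt => t Nt; exists (chart z t) => //; rewrite chartK.
  - by move=> x xr; rewrite /= unchartK.
rewrite -{1}(chart0 z); apply: (star_degree_transfer (U := setT)) st => //.
- exact: openT.
- by move=> t _; exact: chart_continuous.
- by move=> t u _ _; exact: (can_inj (chartK z)).
- by move=> N nN; rewrite chart0; exact: chart_open.
Qed.

Lemma star_degree_pullback (P Q : {poly C}) (S : set C) (k : nat) :
  Q.[0] != 0 -> P - (P.[0] / Q.[0]) *: Q != 0 ->
  star_degree R S (P.[0] / Q.[0]) k.+1 ->
  star_degree R [set t | S (P.[t] / Q.[t])] (0 : C) k.+1 <->
  (wronskian P Q).[0] != 0.
Proof.
move=> Q0 PQ stS; split=> [st|W0]; last exact: star_degree_unramified.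
by apply/eqP => W0; have := star_degree_ramified Q0 W0 PQ stS; apply.
Qed.

(** The quotient of the resolvents has nonzero derivative, or a simple pole, at
    z. Since it is a Moebius transform of lambda, lambda is unramified at z. *)
Definition unramified_at c z := (wronskian (local1 c z) (local2 c z)).[0] != 0.

Lemma wronskianC (P Q : {poly C}) : wronskian Q P = - wronskian P Q.
Proof. by rewrite /wronskian opprB mulrC [Q * _]mulrC. Qed.

(** At a bullet one of the resolvents u and v vanishes, and the dessin is near it
    the preimage of the three rays at 0 by u / v or by v / u. *)
Lemma bullet_degree c z : (0 < n)%N -> bullets (dessin_of c) z ->
  vertex_degree (graph (dessin_of c)) z 3 <-> unramified_at c z.
Proof.
move=> n0; rewrite /= -[X in j_inv c X](chart0 z) j_inv_chart => /bullet_resolventP uv.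
rewrite -[vertex_degree _ _ _]/(star_degree R _ _ _) star_degree_chart graph_chart.
have st0 := star_cube_rays0 R.
case: uv => uv0.
  have v0 : (local2 c z).[0] != 0 by case: (local_neq0 c z 0) => //; rewrite uv0 eqxx.
  apply: star_degree_pullback => //; first exact: (proj1 (local_independent c z _ n0)).
  by rewrite uv0 mul0r.
have u0 : (local1 c z).[0] != 0 by case: (local_neq0 c z 0) => //; rewrite uv0 eqxx.
have -> : [set t | cube_rays ((local1 c z).[t] / (local2 c z).[t])] =
    [set t | cube_rays ((local2 c z).[t] / (local1 c z).[t])].
  by apply/seteqP; split=> t /= /cube_raysV.
rewrite /unramified_at wronskianC hornerN oppr_eq0.
apply: star_degree_pullback => //; first exact: (proj2 (local_independent c z _ n0)).
by rewrite uv0 mul0r.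
Qed.

(** At a circle u / v is a cube root of 1, an interior point of one of the rays. *)
Lemma circle_degree c z : (0 < n)%N -> circles (dessin_of c) z ->
  vertex_degree (graph (dessin_of c)) z 2 <-> unramified_at c z.
Proof.
move=> n0; rewrite /= -[X in j_inv c X](chart0 z) j_inv_chart.
move=> /circle_resolventP[v0 uv].
rewrite -[vertex_degree _ _ _]/(star_degree R _ _ _) star_degree_chart graph_chart.
apply: star_degree_pullback => //; first exact: (proj1 (local_independent c z _ n0)).
exact: star_cube_rays1.
Qed.

Lemma polyfrac_is_derive (P Q : {poly C}) : Q.[0] != 0 ->
  is_derive (0 : C) (1 : C) (fun t : C => P.[t] / Q.[t])
    ((wronskian P Q).[0] / Q.[0] ^+ 2).
Proof.
move=> Q0; set f := fun t => _; set d := _ / _.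
have fd : (fun h => h^-1 *: ((f \o shift 0) (h *: (1 : C)) - f 0)) @ (0 : C)^' --> d.
  have FF : Filter ((0 : C)^') by exact: dnbhs_filter.
  have dn (A : set C) : nbhs (0 : C) A -> (0 : C)^' A.
    by move=> nA; rewrite /dnbhs /within /=; apply: filterS nA.
  have idc : (fun t : C => t) @ (0 : C)^' --> (0 : C).
    exact: dn.
  have cst : (fun=> 0 : C) @ (0 : C)^' --> (0 : C) by exact: cvg_cst.
  have sl := cvg_quotient_slope (P := P) FF Q0 idc cst.
  apply: cvg_trans sl; apply: near_eq_cvg.
  have n1 : \forall t \near (0 : C)^', t != 0 by exact: nbhs_dnbhs_neq.
  have n2 : \forall t \near (0 : C)^', Q.[t] != 0.
    exact: (dn _ (nonroot_near Q0)).
  apply: filterS2 n1 n2 => t t0 Qt.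
  have -> : (f \o shift 0) (t *: (1 : C)) = f t.
    by rewrite /= addr0 /f -[t *: 1]/(t * 1) mulr1.
  rewrite /f quotientB_slope // subr0 -[RHS]/(t^-1 * (t * _)).
  by rewrite mulrA mulVf // mul1r.
by split; [apply/cvg_ex; exists d | exact: cvg_lim].
Qed.

(** The numerator of the derivative of j. Away from the bullets, where U V = 0,
    the circles, where U^3 = V^3, and the poles, where U^3 + V^3 = 0, j is ramified
    exactly where U / V is. *)
Lemma wronskian_j (U V : {poly C}) :
  wronskian ((U * V) ^+ 3 *+ 4) ((U ^+ 3 + V ^+ 3) ^+ 2) =
  (U * V) ^+ 2 * (U ^+ 3 + V ^+ 3) * (V ^+ 3 - U ^+ 3) * wronskian U V *+ 12.
Proof.
rewrite /wronskian derivMn !deriv_exp derivD derivM !deriv_exp /=.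
by ring.
Qed.

Lemma j_inv_odflt c z : (fun t : C => odflt 0 (j_inv c (chart z t))) =
  (fun t => ((local1 c z * local2 c z) ^+ 3 *+ 4).[t] /
            ((local1 c z ^+ 3 + local2 c z ^+ 3) ^+ 2).[t]).
Proof.
apply/funext => t; rewrite j_inv_chart /j_resolvent /proj_point.
rewrite hornerMn !horner_exp hornerD hornerM !horner_exp mulr_natl.
by case: ifP => [/eqP ->|_] //=; rewrite invr0 mulr0.
Qed.

Lemma ramified_unramified c z (s : R) : s != 0 -> s != 1 ->
  j_inv c z = Some s%:C -> ramified (j_inv c) z <-> ~ unramified_at c z.
Proof.
move=> s0 s1; rewrite -[X in j_inv c X](chart0 z) j_inv_chart => jz.
rewrite /ramified j_inv_odflt /unramified_at.
have D0 : ((local1 c z ^+ 3 + local2 c z ^+ 3) ^+ 2).[0] != 0.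
  rewrite horner_exp hornerD !horner_exp; move: jz; rewrite /j_resolvent /proj_point.
  by case: ifP.
have drv := polyfrac_is_derive ((local1 c z * local2 c z) ^+ 3 *+ 4) D0.
have d0 : (wronskian ((local1 c z * local2 c z) ^+ 3 *+ 4)
    ((local1 c z ^+ 3 + local2 c z ^+ 3) ^+ 2)).[0] /
    ((local1 c z ^+ 3 + local2 c z ^+ 3) ^+ 2).[0] ^+ 2 = 0 <->
    (wronskian (local1 c z) (local2 c z)).[0] = 0.
  rewrite wronskian_j.
  move: jz D0; rewrite hornerMn !(horner_exp, hornerM, hornerD, hornerN).
  set u := (local1 c z).[0]; set v := (local2 c z).[0] => jz D0.
  have S0 : u ^+ 3 + v ^+ 3 != 0 by move: D0; rewrite expf_eq0.
  have {jz}jz : 4 * (u * v) ^+ 3 = s%:C * (u ^+ 3 + v ^+ 3) ^+ 2.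
    by apply/proj_point_eq.
  have uv0 : u * v != 0.
    apply: contra_neq s0 => uv0; apply: (@complexI R); apply: (mulIf D0).
    by rewrite -jz uv0 expr0n mulr0 mul0r.
  have uv3 : v ^+ 3 - u ^+ 3 != 0.
    apply: contra_neq s1 => /eqP; rewrite subr_eq0 => /eqP vu.
    by apply: (@complexI R); apply: (mulIf D0); rewrite -jz exprMn vu rmorph1; ring.
  split=> [/eqP|->]; last by rewrite mulr0 mul0rn mul0r.
  rewrite mulf_eq0 invr_eq0 (negPf (expf_neq0 2 D0)) orbF mulrn_eq0 /=.
  have K0 : (u * v) ^+ 2 * (u ^+ 3 + v ^+ 3) * (v ^+ 3 - u ^+ 3) != 0.
    exact: (mulf_neq0 (mulf_neq0 (expf_neq0 2 uv0) S0) uv3).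
  by rewrite mulf_eq0 (negPf K0) => /eqP.
split=> [rm|/negP]; last first.
  by rewrite negbK => /eqP /d0 d_0; rewrite d_0 in drv.
apply/negP; rewrite negbK; apply/eqP/d0.
by have := @derive_val _ _ _ _ _ _ _ drv; have := @derive_val _ _ _ _ _ _ _ rm => ->.
Qed.

Lemma simple_nondegenerate c : (0 < n)%N ->
  simple (dessin_of c) <->
  forall z, graph (dessin_of c) z -> unramified_at c z.
Proof.
move=> n0; split=> [[bul cir mono] z|nd].
  move=> [s /= s01 sz].
  have [s0|s0] := eqVneq s 0.
    have bz : bullets (dessin_of c) z by rewrite /= -sz s0.
    exact/(bullet_degree n0 bz)/bul.
  have [s1|s1] := eqVneq s 1.
    have cz : circles (dessin_of c) z by rewrite /= -sz s1.
    exact/(circle_degree n0 cz)/cir.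
  apply: contrapT => nz; have : monochromes (dessin_of c) z.
    split; first by apply/(ramified_unramified s0 s1 (esym sz)).
    exists s => //; move: s01; rewrite /= !in_itv /= !le_eqVlt => /andP[].
    by rewrite eq_sym (negPf s0) (negPf s1) /= => -> ->.
  by rewrite mono.
have on (s : R) z : 0 <= s <= 1 -> j_inv c z = Some s%:C -> graph (dessin_of c) z.
  by move=> s01 jz; exists s => //=; rewrite in_itv.
split=> [z bz|z cz|].
- apply/(bullet_degree n0 bz)/nd/(on 0); first by rewrite lexx ler01.
  exact: bz.
- apply/(circle_degree n0 cz)/nd/(on 1); first by rewrite lexx ler01.
  exact: cz.
- apply/seteqP; split=> // z [rz [s /= s01 sz]].
  have [s0 s1] : 0 < s /\ s < 1 by move: s01; rewrite in_itv => /andP.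
  have [sn0 sn1] : s != 0 /\ s != 1 by rewrite gt_eqF // lt_eqF.
  move/(ramified_unramified sn0 sn1 (esym sz)) : rz; apply.
  by apply/nd/(on s); rewrite ?(ltW s0) ?(ltW s1).
Qed.

End SimpleDessins.

(** * Openness *)

Section Openness.
Variables (R : realType) (n : nat).
Local Open Scope complex_scope.
Local Notation C := R[i].
Implicit Types (c : crtc R n) (z : P1 R).

(** A closed condition in terms of a and b, valid also for b = 0. *)
Lemma cube_rays_homog (a b : C) :
  cube_rays (a / b) <-> `|a| ^+ 3 * b ^+ 3 = a ^+ 3 * `|b| ^+ 3.
Proof.
have [->|b0] := eqVneq b 0.
  by rewrite /cube_rays /= invr0 mulr0 normr0 !expr0n !mulr0.
rewrite /cube_rays /= -[X in X <-> _]/(is_true (_ <= _)) ger0_def.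
rewrite expr_div_n normrM normfV !normrX.
have b3 : b ^+ 3 != 0 by rewrite expf_neq0.
have nb3 : `|b| ^+ 3 != 0 by rewrite expf_neq0 // normr_eq0.
by rewrite eqr_div //; split=> /eqP.
Qed.

Lemma y_coef_continuous (k : nat) (c : crtc R n) :
  [/\ (fun c' => (y1 c')`_k) @ nbhs c --> (y1 c)`_k,
      (fun c' => (y2 c')`_k) @ nbhs c --> (y2 c)`_k
    & (fun c' => (y3 c')`_k) @ nbhs c --> (y3 c)`_k].
Proof.
have FF : Filter (nbhs c) := nbhs_filter c.
have cc : (@coefficients R n) @ nbhs c --> coefficients c.
  exact: (@initial_continuous _ _ (@coefficients R n) c).
case: (ltnP k n.+1) => kn; last first.
  have y0 (p : {poly C}) : (size p <= n.+1)%N -> p`_k = 0.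
    by move=> sp; rewrite nth_default // (leq_trans sp).
  have E : [/\ (fun c' : crtc R n => (y1 c')`_k) = (fun=> 0),
      (fun c' : crtc R n => (y2 c')`_k) = (fun=> 0) &
      (fun c' : crtc R n => (y3 c')`_k) = (fun=> 0)].
    by split; apply/funext => c'; have [s1 s2 s3] := size_crtc c'; apply: y0.
  have [s1 s2 s3] := size_crtc c; have [E1 E2 E3] := E.
  by rewrite E1 E2 E3 !y0 //; split; exact: cvg_cst.
pose k' := Ordinal kn.
have coefE (p : {poly C}) : p`_k = poly_rV p 0 k' by rewrite mxE.
have E : [/\ (fun c' : crtc R n => (y1 c')`_k) = (fun c' => (coefficients c').1.1 0 k'),
      (fun c' : crtc R n => (y2 c')`_k) = (fun c' => (coefficients c').1.2 0 k') &
      (fun c' : crtc R n => (y3 c')`_k) = (fun c' => (coefficients c').2 0 k')].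
  by split; apply/funext => c'; rewrite coefE.
have [-> -> ->] := E; rewrite !coefE.
have co (M : 'rV[C]_n.+1) : (fun N : 'rV[C]_n.+1 => N 0 k') @ nbhs M --> M 0 k'.
  exact: coord_continuous.
have c1 : (fun c' : crtc R n => (coefficients c').1) @ nbhs c --> (coefficients c).1.
  exact: (cvg_comp _ _ cc cvg_fst).
have c11 : (fun c' : crtc R n => (coefficients c').1.1) @ nbhs c --> (coefficients c).1.1.
  exact: (cvg_comp _ _ c1 cvg_fst).
have c12 : (fun c' : crtc R n => (coefficients c').1.2) @ nbhs c --> (coefficients c).1.2.
  exact: (cvg_comp _ _ c1 cvg_snd).
have c2 : (fun c' : crtc R n => (coefficients c').2) @ nbhs c --> (coefficients c).2.
  exact: (cvg_comp _ _ cc cvg_snd).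
by split; [exact: (cvg_comp _ _ c11 (co _)) | exact: (cvg_comp _ _ c12 (co _))
  | exact: (cvg_comp _ _ c2 (co _))].
Qed.

Definition coef_continuous (h : crtc R n -> {poly C}) :=
  forall (k : nat) c, (fun c' => (h c')`_k) @ nbhs c --> (h c)`_k.

Lemma resolvents_coef_continuous :
  coef_continuous (@resolvent1 R n) /\ coef_continuous (@resolvent2 R n).
Proof.
split=> k c; have FF : Filter (nbhs c) := nbhs_filter c;
  have [Y1 Y2 Y3] := y_coef_continuous k c;
  have cst (a : C) : (fun=> a) @ nbhs c --> a by exact: cvg_cst.
- rewrite /resolvent1 !(coefD, coefZ).
  under eq_fun do rewrite !(coefD, coefZ).
  exact: (cvgD (cvgD Y1 (cvgM (cst _) Y2)) (cvgM (cst _) Y3)).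
- rewrite /resolvent2 !(coefN, coefD, coefZ).
  under eq_fun do rewrite !(coefN, coefD, coefZ).
  exact: (cvgN (cvgD (cvgD Y1 (cvgM (cst _) Y2)) (cvgM (cst _) Y3))).
Qed.

Lemma local_infty_coef_continuous (h : crtc R n -> {poly C}) :
  coef_continuous h -> coef_continuous (fun c => local_poly n None (h c)).
Proof.
move=> ch k c; have FF : Filter (nbhs c) := nbhs_filter c.
rewrite /= coef_poly; under eq_fun do rewrite coef_poly.
by case: ifP => _; [exact: ch | exact: cvg_cst].
Qed.

Lemma cvg_family_horner (h : crtc R n -> {poly C}) (N : nat) (t : C) c :
  (forall c, (size (h c) <= N)%N) -> coef_continuous h ->
  (fun z : C * crtc R n => (h z.2).[z.1]) @ nbhs (t, c) --> (h c).[t].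
Proof.
move=> sh ch; have FF : Filter (nbhs (t, c)) := nbhs_filter (t, c).
have f1 : (fun z : C * crtc R n => z.1) @ nbhs (t, c) --> t by exact: cvg_fst.
have f2 : (fun z : C * crtc R n => z.2) @ nbhs (t, c) --> c by exact: cvg_snd.
have hk (k : nat) : (fun z : C * crtc R n => (h z.2)`_k) @ nbhs (t, c) --> (h c)`_k.
  exact: (cvg_comp _ _ f2 (ch k c)).
exact: (@cvg_horner R _ (nbhs (t, c)) (fun tc => h tc.2) (fun tc => tc.1) (h c) t N
  FF (fun tc => sh tc.2) (sh c) hk f1).
Qed.

(** The condition at (t, c) says that the Wronskian or |U|^3 V^3 - U^3 |V|^3 is
    nonzero, which is open in (t, c). Compactness of K makes it uniform in t. *)
Lemma unramified_on_compact_near (U V : crtc R n -> {poly C}) (K : set C) c : compact K ->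
  (forall c, (size (U c) <= n.+1)%N) -> (forall c, (size (V c) <= n.+1)%N) ->
  coef_continuous U -> coef_continuous V ->
  (forall t, K t -> cube_rays ((U c).[t] / (V c).[t]) ->
     (wronskian (U c) (V c)).[t] != 0) ->
  \forall c' \near c, forall t, K t -> cube_rays ((U c').[t] / (V c').[t]) ->
     (wronskian (U c') (V c')).[t] != 0.
Proof.
move=> /compact_near_coveringP cK sU sV cU cV good.
have FF : Filter (nbhs c) := nbhs_filter c.
apply: (cK _ (nbhs c) (fun c' t => cube_rays ((U c').[t] / (V c').[t]) ->
     (wronskian (U c') (V c')).[t] != 0)) => t Kt.
have FFt : Filter (nbhs (t, c)) := nbhs_filter (t, c).
have sd (h : crtc R n -> {poly C}) : (forall c, (size (h c) <= n.+1)%N) ->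
    forall c, (size ((h c)^`())%R <= n.+1)%N.
  by move=> sh c'; exact: (leq_trans (size_poly _ _) (leq_trans (leq_pred _) (sh c'))).
have cd (h : crtc R n -> {poly C}) : coef_continuous h ->
    coef_continuous (fun c' => ((h c')^`())%R).
  move=> ch k c'; rewrite coef_deriv; under eq_fun do rewrite coef_deriv.
  have FF' : Filter (nbhs c') := nbhs_filter c'.
  apply: cvgMn; exact: ch.
have hU := cvg_family_horner (t := t) (c := c) sU cU.
have hV := cvg_family_horner (t := t) (c := c) sV cV.
have hU' := cvg_family_horner (t := t) (c := c) (sd _ sU) (cd _ cU).
have hV' := cvg_family_horner (t := t) (c := c) (sd _ sV) (cd _ cV).
suff : \forall tc \near (t, c), cube_rays ((U tc.2).[tc.1] / (V tc.2).[tc.1]) ->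
    (wronskian (U tc.2) (V tc.2)).[tc.1] != 0 by [].
have [W0|W0] := eqVneq (wronskian (U c) (V c)).[t] 0.
  have nr : ~ cube_rays ((U c).[t] / (V c).[t]).
    by move=> /(good t Kt); rewrite W0 eqxx.
  have nrm (h : crtc R n -> {poly C}) :
      (fun z : C * crtc R n => (h z.2).[z.1]) @ nbhs (t, c) --> (h c).[t] ->
      (fun z : C * crtc R n => `|(h z.2).[z.1]| ^+ 3) @ nbhs (t, c) -->
      `|(h c).[t]| ^+ 3.
    by move=> hc; exact: (cvgXn (n := 3) FFt (cvg_norm hc)).
  have pw (h : crtc R n -> {poly C}) :
      (fun z : C * crtc R n => (h z.2).[z.1]) @ nbhs (t, c) --> (h c).[t] ->
      (fun z : C * crtc R n => (h z.2).[z.1] ^+ 3) @ nbhs (t, c) --> (h c).[t] ^+ 3.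
    by move=> hc; exact: (cvgXn (n := 3) FFt hc).
  have dc : (fun tc : C * crtc R n => `|(U tc.2).[tc.1]| ^+ 3 * (V tc.2).[tc.1] ^+ 3 -
      (U tc.2).[tc.1] ^+ 3 * `|(V tc.2).[tc.1]| ^+ 3) @ nbhs (t, c) -->
      (`|(U c).[t]| ^+ 3 * (V c).[t] ^+ 3 - (U c).[t] ^+ 3 * `|(V c).[t]| ^+ 3).
    exact: (cvgB (cvgM (nrm U hU) (pw V hV)) (cvgM (pw U hU) (nrm V hV))).
  have d0 : `|(U c).[t]| ^+ 3 * (V c).[t] ^+ 3 - (U c).[t] ^+ 3 * `|(V c).[t]| ^+ 3 != 0.
    by rewrite subr_eq0; apply/eqP => /cube_rays_homog.
  apply: filterS (cvgr_neq0 _ dc d0) => tc nz /cube_rays_homog E.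
  by move: nz; rewrite E subrr eqxx.
have WE (c' : crtc R n) (t' : C) : (wronskian (U c') (V c')).[t'] =
    (((U c')^`()).[t'] * (V c').[t'] - (U c').[t'] * ((V c')^`()).[t'])%R.
  by rewrite /wronskian hornerD hornerN !hornerM.
rewrite WE in W0.
have dc : (fun tc : C * crtc R n =>
    (((U tc.2)^`()).[tc.1] * (V tc.2).[tc.1] - (U tc.2).[tc.1] * ((V tc.2)^`()).[tc.1])%R)
    @ nbhs (t, c) --> (((U c)^`()).[t] * (V c).[t] - (U c).[t] * ((V c)^`()).[t])%R.
  exact: (cvgB (cvgM hU' hV) (cvgM hU hV')).
by apply: filterS (cvgr_neq0 _ dc W0) => tc nz _; rewrite WE.
Qed.

Lemma unramified_finite c (x : C) :
  unramified_at c (Some x) = ((wronskian (resolvent1 c) (resolvent2 c)).[x] != 0).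
Proof. by rewrite /unramified_at /local1 /local2 wronskian_local_finite. Qed.

Lemma unramified_infinite c (t : C) :
  unramified_at c (chart None t) = ((wronskian (local1 c None) (local2 c None)).[t] != 0).
Proof.
have [->|t0] := eqVneq t 0; first by rewrite chart0.
have [s1 s2] := size_resolvents c.
rewrite /= (negPf t0) unramified_finite; congr negb.
rewrite -[RHS](mulrI_eq0 _ (mulfI t0)) wronskian_local_infty // oppr_eq0.
by rewrite !mulf_eq0 invr_eq0 !expf_eq0 (negPf t0) !andbF.
Qed.

Lemma sphere_charts_cover z :
  (exists2 x : C, box 1 x & z = Some x) \/ exists2 t : C, box 1 t & z = chart None t.
Proof.
have b0 : box 1 (0 : C) by apply: norm_le_box; rewrite normr0 ler01.
case: z => [x|]; last by right; exists 0; rewrite ?chart0.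
have [bx|nx] := pselect (box 1 x); first by left; exists x.
right; have x0 : x != 0 by apply/eqP => x_0; apply: nx; rewrite x_0.
exists x^-1; last by rewrite /= invr_eq0 (negPf x0) invrK.
apply: norm_le_box; rewrite normfV rmorph1 invf_le1 ?normr_gt0 //.
by rewrite ltW // real_ltNge ?real1 ?normr_real //; apply/negP => /norm_le_box.
Qed.

(** The unit squares of the charts at 0 and at infinity cover the sphere, which
    reduces the condition on all of the sphere to two conditions on a compact
    set. *)
Lemma nondegenerateP c :
  (forall z, graph (dessin_of c) z -> unramified_at c z) <->
  (forall x, box 1 x -> cube_rays ((resolvent1 c).[x] / (resolvent2 c).[x]) ->
     (wronskian (resolvent1 c) (resolvent2 c)).[x] != 0) /\
  (forall t, box 1 t -> cube_rays ((local1 c None).[t] / (local2 c None).[t]) ->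
     (wronskian (local1 c None) (local2 c None)).[t] != 0).
Proof.
have gf (x : C) : graph (dessin_of c) (Some x) <->
    cube_rays ((resolvent1 c).[x] / (resolvent2 c).[x]).
  rewrite /= j_inv_homog /=; apply: graph_resolventP.
  exact: (resolvents_neq0 c (Some x)).
have gi (t : C) : graph (dessin_of c) (chart None t) <->
    cube_rays ((local1 c None).[t] / (local2 c None).[t]).
  by have := graph_chart c None => /(congr1 (fun A => A t)) /= ->.
split=> [nd|[ndf ndi] z].
  split=> [x _ /gf /nd|t _ /gi /nd]; first by rewrite unramified_finite.
  by rewrite unramified_infinite.
have [[x bx ->] /gf gx|[t bt ->] /gi gt] := sphere_charts_cover z.
  by rewrite unramified_finite; apply: ndf.
by rewrite unramified_infinite; apply: ndi.
Qed.

Lemma nondegenerate_open :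
  open [set c : crtc R n | forall z, graph (dessin_of c) z -> unramified_at c z].
Proof.
rewrite openE => c /nondegenerateP[ndf ndi]; rewrite /interior.
have [cU cV] := resolvents_coef_continuous.
have sU c' := proj1 (size_resolvents c'); have sV c' := proj2 (size_resolvents c').
have FF : Filter (nbhs c) := nbhs_filter c.
have nf := unramified_on_compact_near (@box_compact R 1) sU sV cU cV ndf.
have sl (p : {poly C}) : (size (local_poly n None p) <= n.+1)%N by exact: size_poly.
have ni := unramified_on_compact_near (@box_compact R 1) (fun c => sl (resolvent1 c))
  (fun c => sl (resolvent2 c)) (local_infty_coef_continuous cU)
  (local_infty_coef_continuous cV) ndi.
by apply: filterS2 nf ni => c' nf ni; apply/nondegenerateP.
Qed.

End Openness.

Theorem theorem4 (R : realType) (n : nat) (n_ge1 : (1 <= n)%N) :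
  open [set D : dessin_space R n | simple (dessin_val D)].
Proof.
have dessin_pi (c : crtc R n) :
    dessin_val (\pi_(dessin_space R n)%qT c) = dessin_of c.
  by rewrite /dessin_val unlock.
suff : open ((@generic_quotient.pi _ (dessin_space R n)) @^-1`
    [set D : dessin_space R n | simple (dessin_val D)]) by [].
have -> : (@generic_quotient.pi _ (dessin_space R n)) @^-1`
    [set D : dessin_space R n | simple (dessin_val D)] =
    [set c : crtc R n | simple (dessin_of c)].
  by apply/seteqP; split=> c /=; rewrite dessin_pi.
have -> : [set c : crtc R n | simple (dessin_of c)] =
    [set c : crtc R n | forall z, graph (dessin_of c) z -> unramified_at c z].
  by apply/seteqP; split=> c /=; move/(simple_nondegenerate c n_ge1).
exact: nondegenerate_open.
Qed.
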